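(* Let $F:\mathbb{R}^n\to\mathbb{R}^m$ be continuously differentiable around $\bar x$, let $g:\mathbb{R}^m\to\mathbb{R}\cup\{\infty\}$ be lower semicontinuous and convex with $\bar y:=F(\bar x)\in\operatorname{dom}g$, let $\bar y^*\in\partial g(\bar y)$ and $\bar x^*:=\nabla F(\bar x)^T\bar y^*$. Define $M:\mathbb{R}^n\times\mathbb{R}^n\times\mathbb{R}^m\rightrightarrows\mathbb{R}^m$ by $M(x,x^*,b):=\{y^*\in\partial g(F(x)+b)\mid \nabla F(x)^Ty^*=x^*\}$. Assume that SOQC holds at $\bar x$ for $\bar y^*$ (i.e., for every $L\in\mathcal{S}(\partial g)(\bar y,\bar y^* )$, $\nabla F(\bar x)^Tv^*=0$ and $(0,v^* )\in L$ imply $v^*=0$) and that $\nabla F$ is Lipschitz near $\bar x$. Then there exist a neighborhood $\mathcal{W}$ of $(\bar x,\bar x^*,0)$ and a constant $\kappa\ge0$ such that for all $(x_i,x_i^*,b_i)\in\operatorname{dom}M\cap\mathcal{W}$ and all $y_i^*\in M(x_i,x_i^*,b_i)$, $i=1,2$, $$\|y_1^*-y_2^*\|\le\kappa\|(x_1,x_1^*,b_1)-(x_2,x_2^*,b_2)\|.$$ In particular, $M(x,x^*,b)$ is a singleton for every $(x,x^*,b)\in\operatorname{dom}M\cap\mathcal{W}$.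
   Context: SC derivative: let $\mathcal{Z}_m$ be the set of $m$-dimensional linear subspaces of $\mathbb{R}^m\times\mathbb{R}^m$ with metric $d(L_1,L_2)=\|P_{L_1}-P_{L_2}\|$ ($P_L$ orthogonal projection); let $\mathcal{O}$ be the set of $(y,y^* )\in\operatorname{gph}\partial g$ at which the tangent cone $T_{\operatorname{gph}\partial g}(y,y^* )=\operatorname{Limsup}_{t\downarrow0}(\operatorname{gph}\partial g-(y,y^* ))/t$ is an $m$-dimensional subspace; $\mathcal{S}(\partial g)(y,y^* )$ is the set of $L\in\mathcal{Z}_m$ for which some sequence $(y_k,y_k^* )\in\mathcal{O}$ converging to $(y,y^* )$ satisfies $d(T_{\operatorname{gph}\partial g}(y_k,y_k^* ),L)\to0$. $\operatorname{dom}M=\{(x,x^*,b)\mid M(x,x^*,b)\neq\emptyset\}$. *)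

(* Defs.v *)
From HB Require Import structures.
From mathcomp Require Import all_boot all_order all_algebra.
From mathcomp Require Import all_classical all_reals all_analysis.
Set Implicit Arguments. Unset Strict Implicit. Unset Printing Implicit Defensive.
Import Order.TTheory GRing.Theory Num.Theory.
Import numFieldNormedType.Exports.
Local Open Scope classical_set_scope.
Local Open Scope ring_scope.

Section Defs.
Variable R : realType.

Definition dotv (k : nat) (u v : 'rV[R]_k) : R := \sum_(i < k) u ord0 i * v ord0 i.

(* Jacobian of F at x, in row-vector convention: dF(x) h = h *m jac F x.
   Hence the matrix nabla F(x) of the paper is (jac F x)^T. *)
Definition jac (n m : nat) (F : 'rV[R]_n -> 'rV[R]_m) (x : 'rV[R]_n) : 'M[R]_(n, m) :=
  lin1_mx ('d F x).

Definition adjF (n m : nat) (F : 'rV[R]_n -> 'rV[R]_m) (x : 'rV[R]_n) (ys : 'rV[R]_m)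
  : 'rV[R]_n := ys *m (jac F x)^T.

Definition convex_ext (m : nat) (g : 'rV[R]_m -> \bar R) : Prop :=
  forall (x y : 'rV[R]_m) (t : R), 0 <= t -> t <= 1 ->
    (g (t *: x + (1 - t) *: y)%R <= t%:E * g x + (1 - t)%:E * g y)%E.

Definition subdiff (m : nat) (g : 'rV[R]_m -> \bar R) (y : 'rV[R]_m) : set 'rV[R]_m :=
  [set ys | g y \is a fin_num /\
     forall z, (g y + (dotv ys (z - y)%R)%:E <= g z)%E].

Definition gph_subdiff (m : nat) (g : 'rV[R]_m -> \bar R) : set ('rV[R]_m * 'rV[R]_m) :=
  [set p | subdiff g p.1 p.2].

(* Tangent (contingent) cone: Limsup_{t downarrow 0} (A - z)/t *)
Definition tangent_cone (m : nat) (A : set ('rV[R]_m * 'rV[R]_m)) (z : 'rV[R]_m * 'rV[R]_m)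
  : set ('rV[R]_m * 'rV[R]_m) :=
  [set w | exists (t : nat -> R) (a b : nat -> 'rV[R]_m),
     (forall k, 0 < t k) /\ t @ \oo --> (0 : R) /\
     a @ \oo --> w.1 /\ b @ \oo --> w.2 /\
     forall k, A (z.1 + t k *: a k, z.2 + t k *: b k)].

Definition pair_row (m : nat) (p : 'rV[R]_m * 'rV[R]_m) : 'rV[R]_(m + m) := row_mx p.1 p.2.

Definition subspace_of_dim (m k : nat) (L : set ('rV[R]_m * 'rV[R]_m)) : Prop :=
  exists S : 'M[R]_(m + m), \rank S = k /\
    L = [set p | (pair_row p <= S)%MS].

Definition is_orth_proj (m : nat) (L : set ('rV[R]_m * 'rV[R]_m)) (P : 'M[R]_(m + m)) : Prop :=
  forall v : 'rV[R]_(m + m),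
    L (lsubmx (v *m P), rsubmx (v *m P)) /\
    forall p, L p -> dotv (v - v *m P) (pair_row p) = 0.

Definition O_set (m : nat) (g : 'rV[R]_m -> \bar R) : set ('rV[R]_m * 'rV[R]_m) :=
  [set p | gph_subdiff g p /\ subspace_of_dim m (tangent_cone (gph_subdiff g) p)].

(* SC derivative S(dg)(y, ys): the L in Z_m such that some sequence in O converging
   to (y, ys) has tangent cones T_k with d(T_k, L) = |P_{T_k} - P_L| -> 0 *)
Definition SC_deriv (m : nat) (g : 'rV[R]_m -> \bar R) (y ys : 'rV[R]_m)
  : set (set ('rV[R]_m * 'rV[R]_m)) :=
  [set L | subspace_of_dim m L /\
     exists (yk ysk : nat -> 'rV[R]_m) (Pk : nat -> 'M[R]_(m + m)) (P : 'M[R]_(m + m)),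
       (forall k, O_set g (yk k, ysk k)) /\
       yk @ \oo --> y /\ ysk @ \oo --> ys /\
       (forall k, is_orth_proj (tangent_cone (gph_subdiff g) (yk k, ysk k)) (Pk k)) /\
       is_orth_proj L P /\
       (fun k => `|Pk k - P|) @ \oo --> (0 : R)].

Definition SOQC (n m : nat) (F : 'rV[R]_n -> 'rV[R]_m) (g : 'rV[R]_m -> \bar R)
  (xb : 'rV[R]_n) (ysb : 'rV[R]_m) : Prop :=
  forall L, SC_deriv g (F xb) ysb L ->
    forall vs : 'rV[R]_m, adjF F xb vs = 0 -> L (0, vs) -> vs = 0.

Definition Mmap (n m : nat) (F : 'rV[R]_n -> 'rV[R]_m) (g : 'rV[R]_m -> \bar R)
  (p : 'rV[R]_n * 'rV[R]_n * 'rV[R]_m) : set 'rV[R]_m :=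
  [set ys | subdiff g (F p.1.1 + p.2) ys /\ adjF F p.1.1 ys = p.1.2].

End Defs.

(* Main.v *)
Require Import Defs.
From HB Require Import structures.
From mathcomp Require Import all_boot all_order all_algebra.
From mathcomp Require Import all_classical all_reals all_analysis.
From mathcomp Require Import measurable_realfun ring lra.
Import Order.TTheory GRing.Theory Num.Theory.
Import numFieldNormedType.Exports.
Local Open Scope classical_set_scope.
Local Open Scope ring_scope.
Set Implicit Arguments.
Unset Strict Implicit.

(** The proximal map P of g parametrizes the graph of its subdifferential as
    {(P u, u - P u)}; it is Lipschitz and firmly nonexpansive. Where P has the derivative B, the
    tangent cone of the graph is the subspace {(w B, w - w B)}, so SOQC and compactness make the form
    <v, v B> + |adj v|^2 uniformly coercive over all derivatives at points near the reference
    point. As it is affine in B, it can be integrated along segments: by Rademacher's theorem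
    and Fubini almost every segment parallel to a given one meets the points of differentiability
    of P almost everywhere, and a limit yields c |D|^2 <= <D, P u - P u'> + |adj D|^2 with
    D = u - u'. Applied to u_i = F x_i + b_i + y_i, where P u_i = F x_i + b_i, this bounds
    D, and hence y_1 - y_2, by the perturbation of (x, x^*, b).

    Rademacher's theorem is proved by induction on the number of coordinates, for the sigma-ideal
    generated by the sets that are Lebesgue-null on all lines in some coordinate direction. *)

(** * Lipschitz functions of one variable *)

(** Why the form detects SOQC: firm nonexpansiveness gives <v, v B> >= |v B|^2, so where the form
    vanishes both v B = 0 and adj v = 0. Then (0, v) lies in the tangent subspace belonging to B,
    which is the situation that SOQC excludes.

    Two difficulties remain after coercivity. The adjoint in the form is taken at the fixed point
    [xb], while the multipliers satisfy equations at x_1 and x_2. Lipschitz continuity of the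
    Jacobian turns the discrepancy into a multiple of the perturbation plus a small multiple of |D|,
    which the coercivity constant absorbs. Moreover, coercivity holds only for u near the reference
    point, whereas the neighbourhood W restricts (x, x^*, b) and not the multiplier. The local
    estimate shows that [ysb] is the only nearby multiplier at the reference parameter; monotonicity
    of the subdifferential then keeps all multipliers of nearby parameters close to [ysb]. *)

Section Lipschitz1.
Variable R : realType.
Local Notation lambda := (@lebesgue_measure R).

Definition has_der (f : R -> R) (x d : R) : Prop :=
  forall e, 0 < e -> exists2 dl, 0 < dl &
    forall t, `|t| < dl -> `|f (x + t) - f x - d * t| <= e * `|t|.

Lemma derivable_has_der (f : R -> R) (x : R) :
  derivable f x 1 -> has_der f x (derive1 f x).
Proof.
move=> df e e0.
have := df => /cvg_ex [l]; move=> hl.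
have El : derive1 f x = l by rewrite derive1E; exact: cvg_lim hl.
rewrite El.
have /cvgrPdist_le /(_ _ e0) := hl.
move=> -[dl /= dl0 H].
exists dl => // t tdl.
have [->|t0] := eqVneq t 0; first by rewrite addr0 subrr mulr0 subr0 normr0 mulr0.
have := H t; rewrite /= sub0r normrN => /(_ tdl t0).
rewrite [t *: 1]mulr1 [t + x]addrC => Ht.
have -> : f (x + t) - f x - l * t = - (l - t^-1 * (f (x + t) - f x)) * t by field.
by rewrite normrM normrN ler_wpM2r.
Qed.

Lemma has_der_near (f g : R -> R) (x d r : R) : 0 < r ->
  (forall y, `|y - x| < r -> f y = g y) -> has_der f x d -> has_der g x d.
Proof.
move=> r0 fg fd e /fd [dl dl0 H]; exists (Num.min r dl).
  by rewrite lt_min r0.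
move=> t; rewrite lt_min => /andP[tr tdl].
by rewrite -!fg ?subrr ?normr0 ?[x + t]addrC ?addrK// [t + x]addrC; exact: H.
Qed.

Section density.
Variable h : cumulativeBounded (0 : R) (1 : R).
Variable C : R.
Hypothesis C0 : 0 < C.
Hypothesis hC : forall x y, x <= y -> h y - h x <= C * (y - x).
Local Notation nu := (lebesgue_stieltjes_measure h).

(* Compare the two outer measures on covers by half-open intervals. *)
Lemma lebesgue_stieltjes_dominates : nu `<< lambda.
Proof.
apply/null_content_dominatesP => A mA lA0.
apply/eqP; rewrite eq_le measure_ge0 andbT.
apply/lee_addgt0Pr => e e0; rewrite add0e.
have eC : 0 < e / C by rewrite divr_gt0.
have : (lambda A < (e / C)%:E)%E by rewrite lA0 lte_fin.
move=> /ereal_inf_lt [_ [F [mF AF] <-]] HF.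
have lee k : (wlength h (F k) <= C%:E * wlength idfun (F k))%E.
  have [->|[x x12 ->]] := (ocitvP _).1 (mF k); first by rewrite !wlength0 mule0.
  rewrite !(wlength_itv_bnd _ _ _ (ltW x12)) -EFinM lee_fin.
  exact: hC (ltW x12).
apply: (@le_trans _ _ (\sum_(0 <= k <oo) wlength h (F k))%E).
  by apply: ereal_inf_lbound; exists F.
apply: (@le_trans _ _ (\sum_(0 <= k <oo) (C%:E * wlength idfun (F k)))%E).
  by apply: lee_nneseries => [k _ _|k _]; [|exact: lee].
rewrite nneseriesZl//.
have -> : e%:E = (C%:E * (e / C)%:E)%E by rewrite -EFinM mulrC divfK// gt_eqF.
by rewrite lee_pmul2l// ltW.
Qed.

Lemma lebesgue_stieltjes_itv (x y : R) : x <= y -> nu `]x, y] = (h y - h x)%:E.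
Proof.
move=> xy; rewrite /lebesgue_stieltjes_measure /measure_extension.
by rewrite measurable_mu_extE/= ?wlength_itv_bnd//; exact: is_ocitv.
Qed.

(** The Radon-Nikodym density of the Stieltjes measure integrates back to [h], and Lebesgue
    differentiation ([FTC1]) turns this integral formula into a derivative almost everywhere. *)
Lemma cumulative_density (a : R) : exists phi : R -> R,
  [/\ lambda.-integrable setT (EFin \o phi),
      forall x, a <= x -> h x - h a = \int[lambda]_(t in `]a, x]) phi t &
      {ae lambda, forall x, a < x -> has_der h x (phi x)}].
Proof.
have [f [f0 ffin fint fE]] := radon_nikodym_sigma_finite lebesgue_stieltjes_dominates.
have Ef : EFin \o (fine \o f) = f by apply/funext => x /=; rewrite fineK.
have hE x : a <= x -> h x - h a = \int[lambda]_(t in `]a, x]) (fine \o f) t.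
  move=> ax; rewrite /Rintegral -[LHS]/(fine (h x - h a)%:E); congr fine.
  rewrite -lebesgue_stieltjes_itv// fE//.
  by apply: eq_integral => t _; rewrite -[in LHS]Ef.
exists (fine \o f); split; [by rewrite Ef|exact: hE|].
have loc : locally_integrable [set: R] (fine \o f).
  split; last 1 first.
  - move=> K _ cK; have := fint; rewrite -Ef => /integrableP[mf].
    apply: le_lt_trans; apply: ge0_subset_integral => //=.
      exact: compact_measurable.
    by apply/measurable_EFinP/measurableT_comp/measurable_EFinP => //=; exact: mf.
  - by apply/measurable_EFinP; rewrite Ef; exact: measurable_int fint.
  - exact: openT.
have intf y : lambda.-integrable `]a, y] (EFin \o (fine \o f)).
  by rewrite Ef; apply: integrableS fint.
have := @FTC1 R (fine \o f) (BRight a) intf loc.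
apply: filterS; first exact: (ae_filter_ringOfSetsType lambda).
move=> x H ax.
have [dF <-] := H ax.
apply: (@has_der_near (fun y => \int[lambda]_(t in `]a, y]) (fine \o f) t + h a) h x _ (x - a)).
- by rewrite subr_gt0.
- move=> t xt; rewrite -hE ?subrK//.
  by move: xt; rewrite ltr_norml => /andP[]; lra.
- move=> e e0; have [dl dl0 Hd] := derivable_has_der dF e0.
  by exists dl => // t /Hd; congr (_ <= _); congr `|_|; rewrite opprD addrACA subrr addr0.
Qed.
End density.

(** Composition with this projection onto [a, b] extends a function by constants, which gives it
    limits at both infinities. *)
Definition clamp (a b x : R) : R := if x <= a then a else if b <= x then b else x.

Lemma clamp_mono (a b x y : R) : a < b -> x <= y ->
  0 <= clamp a b y - clamp a b x <= y - x.
Proof.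
rewrite /clamp => ab xy.
by case: (leP x a) => ?; case: (leP b x) => ?; case: (leP y a) => ?;
  case: (leP b y) => ?; apply/andP; split; lra.
Qed.

Section lipschitz.
Variables (f : R -> R) (L : R).
Hypothesis fL : forall x y, `|f x - f y| <= L * `|x - y|.

Let L0 : 0 <= L.
Proof. by have := fL 1 0; rewrite subr0 normr1 mulr1; apply: le_trans. Qed.

(* Adding a steep linear function makes f increasing. *)
Let g (x : R) := f x + (L + 1) * x.

Let g_incr x y : x <= y -> y - x <= g y - g x.
Proof.
move=> xy; have := fL y x; rewrite (ger0_norm (_ : 0 <= y - x)) ?subr_ge0//.
by rewrite ler_norml /g => /andP[H _]; lra.
Qed.

Let g_lip x y : x <= y -> g y - g x <= (L + L + 1) * (y - x).
Proof.
move=> xy; have := fL y x; rewrite (ger0_norm (_ : 0 <= y - x)) ?subr_ge0//.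
by rewrite ler_norml /g => /andP[_ H]; lra.
Qed.

(** To carry a Stieltjes measure, [g] is frozen outside [a, b] and normalised to run from 0 to 1; it
    stays nondecreasing and Lipschitz. *)
Lemma lipschitz_cumulative (a b : R) : a < b ->
  exists2 h : cumulativeBounded (0 : R) (1 : R),
    exists2 C, 0 < C & forall x y, x <= y -> h y - h x <= C * (y - x) &
    forall x, a <= x <= b -> h x = (g x - g a) / (g b - g a).
Proof.
move=> ab; have gab : 0 < g b - g a.
  by apply: lt_le_trans (g_incr (ltW ab)); rewrite subr_gt0.
pose cl (x : R) := clamp a b x.
pose h (x : R) := (g (cl x) - g a) / (g b - g a).
have clE x : a <= x <= b -> cl x = x.
  move=> /andP[ax xb]; rewrite /cl /clamp.
  by case: leP => [xa|_]; [|case: leP => [bx|//]]; apply/le_anti/andP; split.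
have cl_nd x y : x <= y -> cl x <= cl y.
  by move=> xy; have /andP[] := clamp_mono ab xy; rewrite subr_ge0.
have cl_lip x y : x <= y -> cl y - cl x <= y - x.
  by move=> xy; have /andP[] := clamp_mono ab xy.
pose C := (L + L + 1) / (g b - g a).
have C0 : 0 < C by rewrite divr_gt0//; have := L0; lra.
have hC x y : x <= y -> h y - h x <= C * (y - x).
  move=> xy; rewrite /h -mulrBl opprB addrA subrK /C mulrAC ler_pM2r ?invr_gt0 //.
  by apply: le_trans (g_lip (cl_nd _ _ xy)) _; rewrite ler_wpM2l ?cl_lip//; have := L0; lra.
have h_nd x y : x <= y -> h x <= h y.
  move=> xy; rewrite /h ler_pM2r ?invr_gt0 // lerD2r.
  rewrite -subr_ge0; apply: le_trans (g_incr (cl_nd _ _ xy)); rewrite subr_ge0.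
  exact: cl_nd.
have h_rc : right_continuous h.
  apply: right_continuousW => x; apply/cvgrPdist_le => e e0.
  exists (e / C) => /=; first by rewrite divr_gt0.
  move=> y /= xy; have : C * `|x - y| <= e by rewrite -ler_pdivlMl// mulrC ltW.
  apply: le_trans; have [le|/ltW le] := leP x y.
    by rewrite distrC [X in C * X]distrC !ger0_norm ?subr_ge0 ?h_nd ?hC.
  by rewrite !ger0_norm ?subr_ge0 ?h_nd ?hC.
have hNy : h @ -oo --> (0 : R).
  apply/cvgrPdist_le => e e0; near=> x.
  have xa : x <= a by near: x; apply: nbhs_ninfty_le; exact: num_real.
  rewrite /h (_ : cl x = a) ?subrr ?mul0r ?subrr ?normr0 ?ltW//.
  by rewrite /cl /clamp xa.
have hy : h @ +oo --> (1 : R).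
  apply/cvgrPdist_le => e e0; near=> x.
  have xb : b <= x by near: x; apply: nbhs_pinfty_ge; exact: num_real.
  rewrite /h (_ : cl x = b) ?divff ?subrr ?normr0 ?ltW ?gt_eqF//.
  by rewrite /cl /clamp xb leNgt (lt_le_trans ab xb).
pose hb : cumulativeBounded (0 : R) (1 : R) :=
  HB.pack h (isCumulative.Build R _ R h h_nd h_rc)
    (isCumulativeBounded.Build R 0 1 h hNy hy).
exists hb; first by exists C.
by move=> x xab; rewrite /= /h clE.
Unshelve. all: by end_near. Qed.

(** On [a, b] the function f equals c h + g a - (L + 1) x, so its derivative is read off the density
    of h. *)
Lemma lipschitz_density (a b : R) : a < b -> exists phi : R -> R, exists c : R,
  [/\ 0 < c, c = g b - g a, lambda.-integrable setT (EFin \o phi),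
      \int[lambda]_(t in `]a, b]) phi t = 1 &
      {ae lambda, forall x, a < x -> x < b -> has_der f x (c * phi x - (L + 1))}].
Proof.
move=> ab; have gab : 0 < g b - g a.
  by apply: lt_le_trans (g_incr (ltW ab)); rewrite subr_gt0.
have [h [C C0 hC] hE] := lipschitz_cumulative ab.
have [phi [phi_int phiE hder]] := cumulative_density C0 hC a.
exists phi, (g b - g a); split=> //.
  rewrite -phiE ?ltW// !hE ?lexx ?ltW//.
  by rewrite subrr mul0r subr0 divff// gt_eqF.
apply: filterS hder; first exact: (ae_filter_ringOfSetsType lambda).
move=> x H ax xb; have {}H := H ax.
apply: (@has_der_near (fun y => (g b - g a) * h y + g a - (L + 1) * y) f x _ (Num.min (x - a) (b - x))).
- by rewrite lt_min !subr_gt0 ax.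
- move=> y; rewrite lt_min !ltr_norml => /andP[/andP[H1 H2] /andP[H3 H4]].
  rewrite hE; last by apply/andP; split; lra.
  by rewrite mulrC divfK ?gt_eqF// /g; ring.
move=> e e0; have ec : 0 < e / (g b - g a) by rewrite divr_gt0.
have [dl dl0 Hd] := H _ ec; exists dl => // t /Hd Ht.
rewrite [X in `|X|](_ : _ = (g b - g a) * (h (x + t) - h x - phi x * t)); last by ring.
rewrite normrM (gtr0_norm gab) -ler_pdivlMl//.
by rewrite mulrA [_^-1 * e]mulrC.
Qed.

Lemma lipschitz_ae_derivable : {ae lambda, forall x, exists d, has_der f x d}.
Proof.
have H (k : nat) : {ae lambda, forall x, - k.+1%:R < x -> x < k.+1%:R -> exists d, has_der f x d}.
  have ab : - k.+1%:R < k.+1%:R :> R by apply: gtrN; rewrite ltr0Sn.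
  have [phi [c [_ _ _ _]]] := lipschitz_density ab.
  apply: filterS; first exact: (ae_filter_ringOfSetsType lambda).
  by move=> x Hx xa xb; eexists; exact: Hx.
have /= Hn := @negligible_bigcup _ _ _ lambda (fun k => ~` _) H.
apply: negligibleS Hn => x /= nx.
exists (Num.bound `|x|) => //= Hx; apply: nx.
have H1 : `|x| < (Num.bound `|x|).+1%:R.
  by apply: lt_le_trans (archi_boundP (normr_ge0 x)) _; rewrite ler_nat.
by move: H1; rewrite ltr_norml => /andP[? ?]; apply: Hx.
Qed.

(** A bound valid only almost everywhere controls the increment because the density has integral 1
    over the interval: no singular part is lost. *)
Lemma lipschitz_ae_ge (a b ga : R) : a < b ->
  {ae lambda, forall x, a < x -> x < b -> forall d, has_der f x d -> ga <= d} ->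
  ga * (b - a) <= f b - f a.
Proof.
move=> ab Hae; have [phi [c [c0 cE phi_int phi1 Hd]]] := lipschitz_density ab.
(* In terms of the density, ga <= c phi - (L + 1) reads k <= phi. *)
pose k := (ga + (L + 1)) / c.
suff : k * (b - a) <= 1.
  rewrite /k mulrAC ler_pdivrMr// mul1r cE /g => ?; lra.
have D_phi : lambda.-integrable `]a, b] (EFin \o phi) by apply: integrableS phi_int.
have D_k : lambda.-integrable `]a, b] (EFin \o (fun=> k)).
  apply: measurable_bounded_integrable => //.
  - by rewrite /= lebesgue_measure_itv/= lte_fin ab ltry.
  - exact: bounded_cst.
have D_k1 : \int[lambda]_(x in `]a, b]) k = k * (b - a).
  rewrite Rintegral_cst//; congr (_ * _).
  by rewrite /= lebesgue_measure_itv/= lte_fin ab.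
have D_B : \int[lambda]_(x in `]a, b]) (phi x - k) = 1 - k * (b - a).
  by rewrite RintegralB// phi1 D_k1.
rewrite -subr_ge0 -D_B /Rintegral.
(* The integrand equals its absolute value almost everywhere, which gives the sign of the
   integral. *)
rewrite (@ae_eq_integral _ _ _ lambda _ (fun x => `|phi x - k|%:E))//.
- by apply: fine_ge0; apply: integral_ge0 => x _; rewrite lee_fin.
- by apply: measurable_int (integrableB _ D_phi D_k).
- apply/measurable_EFinP/measurableT_comp/measurable_EFinP => //.
  by apply: measurable_int (integrableB _ D_phi D_k).
(* The half-open interval contains b, where the derivative bound says nothing. *)
have nb : {ae lambda, forall x, x != b}.
  exists [set b]; split => //; first exact: lebesgue_measure_set1.
  by move=> x /= /negP; rewrite negbK => /eqP.
apply: filterS3 Hae Hd nb; first exact: (ae_filter_ringOfSetsType lambda).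
move=> x H1 H2 xb; rewrite /= in_itv/= => /andP[ax xb'].
have {xb'}xb : x < b by rewrite lt_neqAle xb.
rewrite ger0_norm// subr_ge0 /k ler_pdivrMr//.
by have := H1 ax xb _ (H2 ax xb); lra.
Qed.

End lipschitz.
End Lipschitz1.

(** * Null sets in several variables *)

Section MatrixNorm.
Variables (R : realType) (p q : nat).
Implicit Types A : 'M[R]_(p, q).

Lemma mx_norm_ub A e : 0 <= e -> (forall i j, `|A i j| <= e) -> `|A| <= e.
Proof.
move=> e0 H; rewrite [`|A|]mx_normrE.
by apply: (bigmax_le _ e0) => -[i j] _; exact: H.
Qed.

Lemma mx_norm_ubS A e : 0 < e -> (forall i j, `|A i j| < e) -> `|A| < e.
Proof.
move=> e0 H; rewrite [`|A|]mx_normrE.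
by apply: (bigmax_lt _ e0) => -[i j] _; exact: H.
Qed.

Lemma mx_entry_norm A i j : `|A i j| <= `|A|.
Proof. by rewrite [`|A|]mx_normrE; exact: (le_bigmax _ _ (i, j)). Qed.

End MatrixNorm.

Section ProductSigmaFinite.
Context d1 d2 (T1 : measurableType d1) (T2 : measurableType d2) (R : realType).
Variables (m1 : {sigma_finite_measure set T1 -> \bar R})
  (m2 : {sigma_finite_measure set T2 -> \bar R}).

Lemma sigma_finite_product_measure : sigma_finite setT (m1 \x m2)%E.
Proof.
have /sigma_finiteP[F [FT Fnd Ffin]] := sigma_finiteT m1.
have /sigma_finiteP[G [GT Gnd Gfin]] := sigma_finiteT m2.
exists (fun n => F n `*` G n).
  apply/esym; rewrite -subTset => -[x y] _.
  have [i _ Fx] : (\bigcup_i F i) x by rewrite -FT.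
  have [j _ Gy] : (\bigcup_j G j) y by rewrite -GT.
  exists (i + j)%N => //; split.
    by move: x Fx; apply/subsetPset/Fnd; rewrite leq_addr.
  by move: y Gy; apply/subsetPset/Gnd; rewrite leq_addl.
move=> n; have [mF Foo] := Ffin n; have [mG Goo] := Gfin n; split.
  exact: measurableX.
by rewrite product_measure1E// lte_mul_pinfty// ge0_fin_numE.
Qed.

(* The canonical sigma-finite structure on products only covers subprobabilities. *)
Definition product_sigma_finite : {sigma_finite_measure set (T1 * T2)%type -> \bar R} :=
  HB.pack (m1 \x m2)%E (Measure_isSigmaFinite.Build _ _ _ (m1 \x m2)%E
    sigma_finite_product_measure).

End ProductSigmaFinite.

Section LineNull.
Variable R : realType.
Local Notation lambda := (@lebesgue_measure R).

(* A substitute for the Borel sets of R^m that needs no sigma-algebra on 'rV[R]_m. *)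
Definition coord_borel (m : nat) (A : set 'rV[R]_m) : Prop :=
  forall d (T : measurableType d) (f : T -> 'rV[R]_m),
    (forall i, measurable_fun setT (fun z => f z ord0 i)) -> measurable (f @^-1` A).

Lemma coord_borel_bigcap m (A : nat -> set 'rV[R]_m) :
  (forall k, coord_borel (A k)) -> coord_borel (\bigcap_k A k).
Proof.
move=> bA d T f mf; rewrite preimage_bigcap.
by apply: bigcapT_measurable => k; exact: bA.
Qed.

Lemma coord_borelI m (A B : set 'rV[R]_m) :
  coord_borel A -> coord_borel B -> coord_borel (A `&` B).
Proof.
by move=> bA bB d T f mf; rewrite preimage_setI; apply: measurableI; [exact: bA|exact: bB].
Qed.

Lemma coord_borel0 m : coord_borel (@set0 'rV[R]_m).
Proof. by move=> d T f mf; rewrite preimage_set0. Qed.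

Lemma coord_borel_translate m (A : set 'rV[R]_m) (v : 'rV[R]_m) :
  coord_borel A -> coord_borel [set x | A (x + v)].
Proof.
move=> bA d T f mf; apply: (bA d T (fun z => f z + v)) => i.
under eq_fun do rewrite mxE.
by apply: measurable_funD => //; exact: mf.
Qed.

(** Boxes with rational centres and radii 1/(k + 1) form a countable base, and the preimage of a box
    is a finite intersection of preimages of intervals. *)
Lemma open_coord_borel m (U : set 'rV[R]_m) : open U -> coord_borel U.
Proof.
move=> oU d T f mf.
pose box (p : 'rV[rat]_m * nat) : set 'rV[R]_m :=
  [set x | forall i, `|x ord0 i - ratr (p.1 ord0 i)| < p.2.+1%:R^-1].
have -> : U = \bigcup_p (if `[< box p `<=` U >] then box p else set0).
  apply/seteqP; split => [x Ux|x [p _]]; last by case: asboolP => // H; exact: H.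
  have /nbhs_ballP[e /= e0 He] := open_nbhs_nbhs (conj oU Ux).
  pose k := Num.bound (2 / e).
  have ke : 2 * k.+1%:R^-1 < e.
    rewrite ltr_pdivrMr ?ltr0Sn// -ltr_pdivrMl// mulrC.
    apply: lt_le_trans (archi_boundP _) _; first by rewrite divr_ge0// ltW.
    by rewrite ler_nat.
  have k0 : 0 < k.+1%:R^-1 :> R by rewrite invr_gt0 ltr0Sn.
  have /choice[q Hq] : forall i, exists q : rat, `|x ord0 i - ratr q| < k.+1%:R^-1.
    move=> i; have : x ord0 i - k.+1%:R^-1 < x ord0 i + k.+1%:R^-1 by move: k0; set u := _^-1; lra.
    move=> /rat_in_itvoo[q]; rewrite in_itv/= => /andP[q1 q2]; exists q.
    move: q1 q2; set u := _^-1 => q1 q2.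
    by rewrite ltr_norml; apply/andP; split; lra.
  exists (\row_i q i, k) => //; case: asboolP => [_ i|[]]; first by rewrite /= mxE.
  move=> y /= Hy; apply: He; rewrite -ball_normE /ball_ /=.
  apply: mx_norm_ubS => // i j.
  rewrite !ord1 !mxE; apply: lt_trans ke.
  have := Hy j; have := Hq j; rewrite /= mxE => H1 H2.
  have -> : x 0 j - y 0 j = (x 0 j - ratr (q j)) - (y 0 j - ratr (q j)) by lra.
  by apply: le_lt_trans (ler_normB _ _) _; rewrite mulr2n mulrDl mul1r ltrD.
rewrite preimage_bigcup; apply: countable_bigcupT_measurable => // p.
case: asboolP => [_|_]; last by rewrite preimage_set0.
have -> : f @^-1` box p = \bigcap_(i in [set: 'I_m])
    ((fun z => f z ord0 i - ratr (p.1 ord0 i)) @^-1` [set t | `|t| < p.2.+1%:R^-1]).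
  by apply/seteqP; split => z /= H i; [move=> _; exact: H|exact: (H i Logic.I)].
apply: fin_bigcap_measurable => [|i _]; first exact: finite_finset.
rewrite -[X in measurable X]setTI.
have : measurable_fun setT (fun z => f z ord0 i - ratr (p.1 ord0 i)) by exact: measurable_funB.
apply=> //; rewrite (_ : [set t | _] = `]- p.2.+1%:R^-1, p.2.+1%:R^-1[%classic)//.
by apply/seteqP; split => t; rewrite /= in_itv/= ltr_norml.
Qed.

Definition line_null (m : nat) (i : 'I_m) (E : set 'rV[R]_m) : Prop :=
  coord_borel E /\ forall x, lambda [set t : R | E (x + t *: delta_mx ord0 i)] = 0.

(* Sets covered by countably many line-null sets, in possibly different coordinate directions. *)
Definition coord_null (m : nat) (E : set 'rV[R]_m) : Prop :=
  exists A : nat -> set 'rV[R]_m,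
    (forall k, A k = set0 \/ exists i, line_null i (A k)) /\ E `<=` \bigcup_k A k.

Lemma line_null_translate m (i : 'I_m) (E : set 'rV[R]_m) (v : 'rV[R]_m) :
  line_null i E -> line_null i [set x | E (x + v)].
Proof.
move=> [bE nE]; split; first exact: coord_borel_translate.
move=> x; rewrite -[RHS](nE (x + v)); congr (lambda _).
by apply/funext => t /=; rewrite addrAC.
Qed.

Lemma coord_null_bigcup m (E : nat -> set 'rV[R]_m) :
  (forall k, coord_null (E k)) -> coord_null (\bigcup_k E k).
Proof.
move=> /choice[A HA].
exists (fun n => if unpickle n is Some p then A p.1 p.2 else set0); split.
  move=> n; case: unpickle => [p|]; last by left.
  by have [] := HA p.1.
move=> x [k _ Ex]; have [_ /(_ _ Ex)[j _ Ax]] := HA k.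
by exists (pickle (k, j)) => //; rewrite pickleK.
Qed.

Lemma coord_null0 m : coord_null (@set0 'rV[R]_m).
Proof. by exists (fun=> set0); split => //; left. Qed.

Lemma coord_nullS m (E F : set 'rV[R]_m) : E `<=` F -> coord_null F -> coord_null E.
Proof. by move=> EF [A [HA FA]]; exists A; split => //; exact: subset_trans FA. Qed.

Lemma coord_null_line m i (E : set 'rV[R]_m) : line_null i E -> coord_null E.
Proof.
by move=> nE; exists (fun=> E); split; [right; exists i|move=> x Ex; exists 0%N].
Qed.

Lemma coord_null_countType (I : countType) m (E : I -> set 'rV[R]_m) :
  (forall k, coord_null (E k)) -> coord_null (\bigcup_k E k).
Proof.
move=> HE; pose E' n := if unpickle n is Some p then E p else set0.
apply: (@coord_nullS _ _ (\bigcup_k E' k)).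
  by move=> x [k _ Ex]; exists (pickle k) => //; rewrite /E' pickleK.
apply: coord_null_bigcup => n; rewrite /E'; case: unpickle => [p|]; first exact: HE.
exact: coord_null0.
Qed.

Lemma coord_nullU m (E F : set 'rV[R]_m) :
  coord_null E -> coord_null F -> coord_null (E `|` F).
Proof.
move=> nE nF; apply: (@coord_nullS _ _ (\bigcup_b (if b then E else F))).
  by move=> x [Ex|Fx]; [exists true|exists false].
by apply: coord_null_countType; case.
Qed.

Lemma row_mx_shiftl n1 n2 (A : 'rV[R]_n1) (B : 'rV[R]_n2) t (j : 'I_n1) :
  row_mx A B + t *: delta_mx ord0 (lshift n2 j) = row_mx (A + t *: delta_mx ord0 j) B.
Proof. by rewrite delta_mx_lshift scale_row_mx add_row_mx scaler0 addr0. Qed.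

Lemma row_mx_shiftr n1 n2 (A : 'rV[R]_n1) (B : 'rV[R]_n2) t (j : 'I_n2) :
  row_mx A B + t *: delta_mx ord0 (rshift n1 j) = row_mx A (B + t *: delta_mx ord0 j).
Proof. by rewrite delta_mx_rshift scale_row_mx add_row_mx scaler0 addr0. Qed.

Lemma ball_row_mx n1 n2 (x : 'rV[R]_(n1 + n2)) e (A : 'rV[R]_n1) (B : 'rV[R]_n2) :
  ball (lsubmx x) e A -> ball (rsubmx x) e B -> ball x e (row_mx A B).
Proof.
move=> [e0 HA] [_ HB]; split => // i j; rewrite -[x](@hsubmxK _ 1 n1 n2).
by case: (split_ordP j) => k ->; rewrite ?row_mxEl ?row_mxEr.
Qed.

(* Lebesgue measure on R^m, built as an iterated product and transported by emb. *)
Lemma null_space (m : nat) :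
  exists d (T : measurableType d) (mu : {sigma_finite_measure set T -> \bar R})
    (emb : T -> 'rV[R]_m),
    [/\ forall i, measurable_fun setT (fun z => emb z ord0 i),
        forall i E, line_null i E -> mu (emb @^-1` E) = 0 &
        forall U, open U -> U !=set0 -> mu (emb @^-1` U) != 0].
Proof.
elim: m => [|m [d [T [mu [emb [memb null pos]]]]]].
  exists _, unit, (\d_tt : {sigma_finite_measure set unit -> \bar R}), (fun=> 0).
  split => [[]//|[]//|U oU [x Ux]].
  have x0 : (0 : 'rV[R]_0) = x by apply/rowP; case.
  by rewrite /= diracE mem_set ?oner_eq0//= x0.
pose emb' (p : measurableTypeR R * T) : 'rV[R]_(1 + m) := row_mx (p.1)%:M (emb p.2).
have memb' i : measurable_fun setT (fun z => emb' z ord0 i).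
  case: (@split_ordP 1 m i) => j ->.
    under eq_fun do rewrite /emb' row_mxEl !ord1 mxE eqxx mulr1n.
    exact: measurable_fst.
  under eq_fun do rewrite /emb' row_mxEr.
  exact: (measurableT_comp (memb j) measurable_snd).
exists _, _, (product_sigma_finite lambda mu), emb'; split=> //.
- move=> i E [bE nE]; have mE := bE _ _ _ memb'.
  rewrite -[LHS]/((lambda \x mu)%E (emb' @^-1` E)).
  move: nE; case: (@split_ordP 1 m i) => j -> nE.
    (* Direction of the new coordinate: integrated innermost, it makes each slice a line, null by
       hypothesis. *)
    rewrite (@product_measure_unique _ _ _ _ _ lambda mu (lambda \x^ mu)%E)//; last first.
      by move=> A B mA mB; exact: product_measure2E.
    rewrite /product_measure2; apply: integral0_eq => z _ /=.
    rewrite -[RHS](nE (row_mx (0 : 'rV_1) (emb z))); congr (lambda _).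
    apply/funext => t; rewrite ysectionE /= /emb'; congr (E _).
    have -> : row_mx 0 (emb z) + t *: delta_mx ord0 (lshift m j) = row_mx (0 + t *: delta_mx ord0 j) (emb z) :> 'rV_(1 + m).
      exact: row_mx_shiftl.
    suff <- : (t%:M : 'M[R]_1) = 0 + t *: delta_mx ord0 j by [].
    by apply/rowP => k; rewrite !ord1 !mxE !eqxx mulr1n mulr1 add0r.
  (* Direction of an old coordinate: with the new one fixed, the slice is line-null in R^m and the
     induction hypothesis applies. *)
  rewrite /product_measure1; apply: integral0_eq => t _ /=.
  have nEt : line_null j [set w : 'rV[R]_m | E (row_mx (t%:M : 'M[R]_1) w)].
    split; last first.
      move=> w; rewrite -[RHS](nE (row_mx (t%:M : 'M[R]_1) w)); congr (lambda _).
      apply/funext => s /=; congr (E _).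
      exact: (esym (@row_mx_shiftr 1 m t%:M w s j)).
    move=> d' T' f mf; apply: (bE _ _ (fun z => row_mx (t%:M : 'M[R]_1) (f z))).
    suff H (k : 'I_(1 + m)) :
      measurable_fun setT (fun z => row_mx (t%:M : 'M[R]_1) (f z) ord0 k) by exact: H.
    case: (@split_ordP 1 m k) => l ->.
      under eq_fun do rewrite row_mxEl.
      exact: measurable_cst.
    under eq_fun do rewrite row_mxEr.
    exact: mf.
  rewrite -[RHS](null _ _ nEt); congr (mu _).
  by apply/funext => z; rewrite xsectionE.
- move=> U oU [x Ux].
  have /nbhs_ballP[e /= e0 He] := open_nbhs_nbhs (conj oU Ux).
  pose x' : 'rV[R]_(1 + m) := x.
  pose x1 := lsubmx x' ord0 ord0; pose x2 := rsubmx x'.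
  have mA : measurable (emb @^-1` ball x2 e) by apply: (open_coord_borel (ball_open _ _)).
  have mA1 : measurable (ball x1 e : set (measurableTypeR R)) by exact: measurable_ball.
  have : (0 < (lambda \x mu) (ball x1 e `*` (emb @^-1` ball x2 e)))%E.
    rewrite product_measure1E// mule_gt0//.
      by rewrite [X in (0 < X)%E](lebesgue_measure_ball x1 (ltW e0)) lte_fin mulrn_wgt0.
    rewrite lt0e measure_ge0 andbT; apply: pos; first exact: ball_open.
    by exists x2; exact: ballxx.
  move=> H; rewrite gt_eqF//; apply: lt_le_trans H _; apply: le_measure.
  + by rewrite inE; exact: measurableX.
  + by rewrite inE; apply: (open_coord_borel oU).
  + move=> [t z] [/= H1 H2]; apply: He; apply: (@ball_row_mx 1 m x') => //.
    by split => // i j; rewrite !ord1 !mxE eqxx mulr1n; move: H1; rewrite /x1 mxE.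
Qed.

(* Fubini for lebesgue \x mu and the shear (t, z) |-> emb z + t *: v: each slice t = cst is
   a translate of E, hence null, so almost every line in direction v meets E in a null set. *)
Lemma coord_null_transversal m (E U : set 'rV[R]_m) (v : 'rV[R]_m) :
  coord_null E -> open U -> U !=set0 ->
  exists2 x, U x & {ae lambda, forall t, ~ E (x + t *: v)}.
Proof.
move=> [A [HA EA]] oU U0.
have [d [T [mu [emb [memb null pos]]]]] := null_space m.
pose G k : set (measurableTypeR R * T) := [set p | A k (emb p.2 + p.1 *: v)].
have bA k : coord_borel (A k).
  by have [->|[i []//]] := HA k; exact: coord_borel0.
have mG k : measurable (G k).
  apply: (bA k _ _ (fun p : measurableTypeR R * T => emb p.2 + p.1 *: v)) => i.
  under eq_fun do rewrite !mxE.
  apply: measurable_funD; first exact: (measurableT_comp (memb i) measurable_snd).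
  by apply: measurable_funM => //; exact: measurable_fst.
have H k : mu.-negligible (~` [set z | lambda (ysection (G k) z) = 0]).
  have : (\int[mu]_z (lambda (ysection (G k) z)) = 0)%E.
    rewrite -[LHS]/((lambda \x^ mu)%E (G k)).
    rewrite -(@product_measure_unique _ _ _ _ _ lambda mu (lambda \x^ mu)%E)//; last first.
      by move=> B C mB mC; exact: product_measure2E.
    rewrite /product_measure1; apply: integral0_eq => t _ /=.
    have [A0|[i nA]] := HA k.
      by rewrite (_ : G k = set0) ?xsection0 ?measure0// /G A0.
    rewrite -[RHS](null _ _ (line_null_translate (t *: v) nA)); congr (mu _).
    by apply/funext => z; rewrite xsectionE.
  move=> int0.
  have : ae_eq mu setT (lambda \o ysection (G k)) (cst 0%E).
    apply/ae_eq_integral_abs => //; first exact: measurable_fun_ysection.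
    by rewrite -[RHS]int0; apply: eq_integral => z _ /=; rewrite gee0_abs.
  by apply: negligibleS => z /= nz Hz; apply: nz; exact: Hz.
have [N [mN N0 HN]] := negligible_bigcup H.
(* The open set has positive measure, so the exceptional null set cannot contain it. *)
have [z zN Uz] : exists2 z, ~ N z & U (emb z).
  apply: contrapT => nex; have := pos _ oU U0; move/eqP; apply.
  apply: (subset_measure0 _ mN _ N0); first exact: (open_coord_borel oU).
  by move=> z Uz; apply: contrapT => zN; apply: nex; exists z.
exists (emb z) => //.
have Hz k : lambda (ysection (G k) z) = 0.
  by apply: contrapT => nz; apply: zN; apply: HN; exists k.
have Hk k : lambda.-negligible (ysection (G k) z).
  by exists (ysection (G k) z); split => //; exact: measurable_ysection.
apply: negligibleS (negligible_bigcup Hk) => t /= /contrapT Et.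
by have [k _ Ak] := EA _ Et; exists k => //; rewrite ysectionE.
Qed.
End LineNull.

(** * Rademacher's theorem *)

Section Rademacher.
Variables (R : realType) (m : nat).
Local Notation lambda := (@lebesgue_measure R).
Implicit Types (f : 'rV[R]_m -> R) (x h : 'rV[R]_m).

Lemma lipschitz_cts f (L : R) : (forall x y, `|f x - f y| <= L * `|x - y|) -> continuous f.
Proof.
move=> fL x; have FF : Filter (nbhs x) by exact: nbhs_filter.
apply/cvgrPdist_le => e e0.
have d0 : 0 < e / (`|L| + 1) by rewrite divr_gt0 ?ltr_wpDl.
apply: filterS (nbhsx_ballx x _ d0) => y; rewrite -ball_normE /= => xy; apply: le_trans (fL _ _) _.
apply: (@le_trans _ _ ((`|L| + 1) * `|x - y|)).
  by rewrite ler_wpM2r// (le_trans (ler_norm _)) ?lerDl.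
by rewrite -ler_pdivlMl ?ltr_wpDl// mulrC ltW.
Qed.

Lemma exists_inv_lt (e : R) : 0 < e -> exists p : nat, p.+1%:R^-1 < e.
Proof.
move=> e0; exists (Num.bound e^-1); rewrite -[ltRHS]invrK ltf_pV2 ?posrE ?invr_gt0 ?ltr0Sn//.
apply: lt_le_trans (archi_boundP _) _; last by rewrite ler_nat.
by rewrite invr_ge0 ltW.
Qed.

Lemma norm_delta_mx p q (i : 'I_p) (j : 'I_q) : `|delta_mx i j : 'M[R]_(p, q)| = 1.
Proof.
apply/le_anti/andP; split.
  by apply: mx_norm_ub => // k l; rewrite mxE; case: (_ && _); rewrite ?normr1 ?normr0.
by apply: le_trans (mx_entry_norm _ i j); rewrite mxE !eqxx normr1.
Qed.

Section line_derivative.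
Variables (f : 'rV[R]_m -> R) (L : R) (i : 'I_m).
Hypothesis fL : forall x y, `|f x - f y| <= L * `|x - y|.
Local Notation e := (delta_mx ord0 i : 'rV[R]_m).

Let quot x (t : R) := (f (x + t *: e) - f x) / t.

Let small (p : nat) (t : R) := t != 0 /\ `|t| < p.+1%:R^-1.

(* Points where the difference quotients oscillate across [ab.1, ab.2]. *)
Let osc_set (ab : rat * rat) : set 'rV[R]_m :=
  (\bigcap_p [set x | exists2 t, small p t & ratr ab.2 < quot x t]) `&`
  (\bigcap_p [set x | exists2 t, small p t & quot x t < ratr ab.1]).

Let quot_cts t : continuous (quot^~ t).
Proof.
apply: (@lipschitz_cts _ ((L + L) * `|t^-1|)) => x y.
rewrite /quot -mulrBl normrM mulrAC ler_wpM2r// mulrDl.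
have -> : f (x + t *: e) - f x - (f (y + t *: e) - f y) =
  (f (x + t *: e) - f (y + t *: e)) - (f x - f y) by ring.
apply: le_trans (ler_normB _ _) _; rewrite lerD ?fL//.
by apply: le_trans (fL _ _) _; rewrite opprD addrACA subrr addr0.
Qed.

(** The union over t is uncountable but consists of open sets; only the intersection over p leaves
    the open sets, and it is countable. *)
Let osc_borel ab : coord_borel (osc_set ab).
Proof.
apply: coord_borelI; apply: coord_borel_bigcap => p; apply: open_coord_borel.
  rewrite (_ : [set x | _] = \bigcup_(t in small p) (quot^~ t @^-1` [set y | ratr ab.2 < y])).
    apply: bigcup_open => t _; apply: open_comp; last exact: open_gt.
    by move=> x _; exact: quot_cts.
  by apply/seteqP; split=> x [t ? ?]; exists t.
rewrite (_ : [set x | _] = \bigcup_(t in small p) (quot^~ t @^-1` [set y | y < ratr ab.1])).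
  apply: bigcup_open => t _; apply: open_comp; last exact: open_lt.
  by move=> x _; exact: quot_cts.
by apply/seteqP; split=> x [t ? ?]; exists t.
Qed.

Let has_der_quot x d : has_der (fun t => f (x + t *: e)) 0 d ->
  forall eps, 0 < eps -> exists p, forall t, small p t -> `|quot x t - d| <= eps.
Proof.
move=> H eps eps0; have [dl dl0 Hd] := H _ eps0.
have [p Hp] := exists_inv_lt dl0; exists p => t [t0 tp].
have := Hd t (lt_trans tp Hp); rewrite add0r scale0r addr0.
have -> : f (x + t *: e) - f x - d * t = (quot x t - d) * t by rewrite /quot mulrBl divfK.
by rewrite normrM ler_pM2r ?normr_gt0.
Qed.

(** Where the restriction to the line is differentiable, the quotients cannot oscillate across a
    fixed gap at all scales; the one-variable theorem does the rest. *)
Let osc_line_null (ab : rat * rat) : ab.1 < ab.2 -> line_null i (osc_set ab).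
Proof.
move=> ab12; split; first exact: osc_borel.
move=> x; pose g t := f (x + t *: e).
have gL s t : `|g s - g t| <= L * `|e| * `|s - t|.
  apply: le_trans (fL _ _) _.
  by rewrite opprD addrACA subrr add0r -scalerBl normrZ -mulrA [`|e| * _]mulrC.
have mG : measurable ([set t | osc_set ab (x + t *: e)] : set (measurableTypeR R)).
  apply: (@osc_borel ab _ (measurableTypeR R) (fun t : measurableTypeR R => x + (t : R) *: e : 'rV[R]_m)) => j.
  under eq_fun do rewrite !mxE.
  by apply: measurable_funD => //; apply: measurable_funM.
have [N [mN N0 HN]] := lipschitz_ae_derivable gL.
apply: (subset_measure0 mG mN _ N0).
apply: subset_trans HN => t /= [/(_ _ Logic.I) H1 /(_ _ Logic.I) H2] [d Hd].
have {}Hd : has_der (fun s => f (x + t *: e + s *: e)) 0 d.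
  move=> eps /Hd[dl dl0 H]; exists dl => // s /H.
  by rewrite /g /= add0r scale0r addr0 -(addrA x) -scalerDl.
have e0 : 0 < (ratr ab.2 - ratr ab.1) / 3%:R :> R.
  by rewrite divr_gt0// subr_gt0 ltr_rat.
have [p Hp] := has_der_quot Hd e0.
have [s1 /Hp] := H1 p; rewrite ler_norml => /andP[_ ? ?].
have [s2 /Hp] := H2 p; rewrite ler_norml => /andP[? _ ?].
have : ratr ab.1 < ratr ab.2 :> R by rewrite ltr_rat.
lra.
Qed.

(** Outside the oscillation sets of all rational pairs the quotients converge, to the supremum of
    their eventual lower bounds. *)
Lemma line_derivative_coord_null :
  coord_null [set x | ~ exists d, has_der (fun t => f (x + t *: e)) 0 d].
Proof.
have L0 : 0 <= L by have := fL e 0; rewrite subr0 norm_delta_mx mulr1; apply: le_trans.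
pose E (ab : rat * rat) := if ab.1 < ab.2 then osc_set ab else set0.
have nE : coord_null (\bigcup_ab E ab).
  apply: coord_null_countType => ab; rewrite /E; case: ifP => ab12.
    exact: coord_null_line (osc_line_null ab12).
  exact: coord_null0.
apply: coord_nullS nE => x; apply: contra_notP => nEx.
have qL t : t != 0 -> `|quot x t| <= L.
  move=> t0; rewrite /quot normrM normfV ler_pdivrMr ?normr_gt0//.
  apply: le_trans (fL _ _) _; by rewrite addrC addKr normrZ norm_delta_mx mulr1.
pose S : set R := [set b | exists p, forall t, small p t -> b <= quot x t].
have small_half p : small p (p.+1%:R^-1 / 2).
  split; first by rewrite mulf_neq0// invr_eq0 pnatr_eq0.
  rewrite ger0_norm ?divr_ge0// ltr_pdivrMr// ltr_pMr ?ltr1n//.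
have SL : S (- L).
  by exists 0%N => t [t0 _]; have := qL t t0; rewrite ler_norml => /andP[].
have hS : has_sup S.
  split; first by exists (- L).
  exists L => b [p Hp]; have [h0 h1] := small_half p; apply: le_trans (Hp _ (small_half p)) _.
  by have := qL _ h0; rewrite ler_norml => /andP[].
exists (sup S) => eps eps0.
have [b [p1 Hp1] b1] := sup_adherent eps0 hS.
(* Otherwise two rationals between [sup S] and [sup S + eps] are crossed at every scale, and x lies
   in an oscillation set. *)
have [p2 Hp2] : exists p, forall t, small p t -> quot x t <= sup S + eps.
  apply: contrapT => nq.
  have [a] : exists a : rat, sup S < ratr a < sup S + eps.
    have : sup S < sup S + eps by rewrite ltrDl.
    by move=> /rat_in_itvoo[a]; rewrite in_itv => Ha; exists a.
  move=> /andP[a1 a2].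
  move: (a2) => /rat_in_itvoo[b']; rewrite in_itv => /andP[b'1 b'2].
  have ab : a < b' by rewrite -(ltr_rat R).
  apply: nEx; exists (a, b') => //=.
  rewrite /E /= ab; split => p _ /=.
    apply: contrapT => nt; apply: nq; exists p => t tp; rewrite leNgt; apply/negP => tq.
    by apply: nt; exists t => //; exact: lt_trans tq.
  apply: contrapT => nt; have : S (ratr a).
    by exists p => t tp; rewrite leNgt; apply/negP => tq; apply: nt; exists t.
  by move=> /(ub_le_sup hS.2); rewrite leNgt a1.
exists (Num.min p1.+1%:R^-1 p2.+1%:R^-1) => [|t]; first by rewrite lt_min !invr_gt0 !ltr0Sn.
rewrite lt_min => /andP[t1 t2]; rewrite add0r scale0r addr0.
have [->|t0] := eqVneq t 0; first by rewrite scale0r addr0 subrr mulr0 subr0 normr0 mulr0.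
have -> : f (x + t *: e) - f x - sup S * t = (quot x t - sup S) * t by rewrite /quot mulrBl divfK.
rewrite normrM ler_pM2r ?normr_gt0// ler_norml.
have := Hp1 t (conj t0 t1); have := Hp2 t (conj t0 t2) => ? ?.
by apply/andP; split; lra.
Qed.

End line_derivative.
End Rademacher.

(** * Inner product and maximum norm *)

Section DotNorm.
Variables (R : realType) (m : nat).
Implicit Types u v w : 'rV[R]_m.

Lemma dotvC u v : dotv u v = dotv v u.
Proof. by apply: eq_bigr => i _; rewrite mulrC. Qed.

Lemma dotvDl u v w : dotv (u + v) w = dotv u w + dotv v w.
Proof. by rewrite -big_split; apply: eq_bigr => i _; rewrite mxE mulrDl. Qed.

Lemma dotvZl (a : R) u w : dotv (a *: u) w = a * dotv u w.
Proof. by rewrite mulr_sumr; apply: eq_bigr => i _; rewrite mxE mulrA. Qed.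

Lemma dotvNl u w : dotv (- u) w = - dotv u w.
Proof. by rewrite -scaleN1r dotvZl mulN1r. Qed.

Lemma dotvBl u v w : dotv (u - v) w = dotv u w - dotv v w.
Proof. by rewrite dotvDl dotvNl. Qed.

Lemma dotvDr u v w : dotv w (u + v) = dotv w u + dotv w v.
Proof. by rewrite dotvC dotvDl !(dotvC w). Qed.

Lemma dotvZr (a : R) u w : dotv w (a *: u) = a * dotv w u.
Proof. by rewrite dotvC dotvZl dotvC. Qed.

Lemma dotvNr u w : dotv w (- u) = - dotv w u.
Proof. by rewrite dotvC dotvNl dotvC. Qed.

Lemma dotvBr u v w : dotv w (u - v) = dotv w u - dotv w v.
Proof. by rewrite dotvDr dotvNr. Qed.

Lemma dotv0r u : dotv u 0 = 0.
Proof. by rewrite -(scale0r u) dotvZr mul0r. Qed.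

Lemma dotv0l u : dotv 0 u = 0.
Proof. by rewrite dotvC dotv0r. Qed.

Lemma dotv_ge0 u : 0 <= dotv u u.
Proof. by apply: sumr_ge0 => i _; rewrite -expr2 sqr_ge0. Qed.

(** The norm of rows is the maximum norm while [dotv] is Euclidean; this bound and
    [norm_sqr_le_dotv] translate between them, hence the dimension factors in later constants. *)
Lemma dotv_norm_le u v : `|dotv u v| <= m%:R * `|u| * `|v|.
Proof.
apply: le_trans (ler_norm_sum _ _ _) _.
apply: (@le_trans _ _ (\sum_(i < m) `|u| * `|v|)).
  by apply: ler_sum => i _; rewrite normrM ler_pM ?mx_entry_norm.
by rewrite sumr_const card_ord -mulrA mulr_natl.
Qed.

Lemma norm_sqr_le_dotv u : `|u| ^+ 2 <= dotv u u.
Proof.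
have d0 := dotv_ge0 u.
rewrite -[leRHS](sqr_sqrtr d0) ler_sqr ?nnegrE ?sqrtr_ge0//.
apply: mx_norm_ub; first exact: sqrtr_ge0.
move=> i j; rewrite ord1 -sqrtr_sqr ler_wsqrtr// /dotv (bigD1 j)//= -expr2 lerDl.
by apply: sumr_ge0 => k _; rewrite -expr2 sqr_ge0.
Qed.

Lemma dotv_eq0 u : dotv u u <= 0 -> u = 0.
Proof.
move=> u0; apply/eqP; rewrite -normr_eq0 -sqrf_eq0 eq_le sqr_ge0 andbT.
exact: le_trans (norm_sqr_le_dotv u) u0.
Qed.

End DotNorm.

(** * Distance to a set *)

Section SetDistance.
Variables (R : realType) (m : nat) (K : set 'rV[R]_m).
Hypothesis K0 : K !=set0.

Definition setdist (x : 'rV[R]_m) : R := inf [set `|x - y| | y in K].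

Let has_inf_dist x : has_inf [set `|x - y| | y in K].
Proof.
split; first by have [y Ky] := K0; exists `|x - y|; exists y.
by exists 0 => _ [y _ <-].
Qed.

Lemma setdist_le x y : K y -> setdist x <= `|x - y|.
Proof. by move=> Ky; apply: ge_inf; [exact: (has_inf_dist x).2|exists y]. Qed.

Lemma setdist_ge0 x : 0 <= setdist x.
Proof. by apply: lb_le_inf; [exact: (has_inf_dist x).1|move=> _ [y _ <-]]. Qed.

Lemma setdist_in x : K x -> setdist x = 0.
Proof.
move=> Kx; apply/le_anti; rewrite setdist_ge0 andbT.
by apply: le_trans (setdist_le x Kx) _; rewrite subrr normr0.
Qed.

Lemma setdist_lt x r : setdist x < r -> exists2 y, K y & `|x - y| < r.
Proof.
move=> xr; have r0 : 0 < r - setdist x by rewrite subr_gt0.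
have [_ [y Ky <-] H] := inf_adherent r0 (has_inf_dist x).
by exists y => //; move: H; rewrite [ltRHS]addrC subrK.
Qed.

Lemma setdist_lipschitz x y : `|setdist x - setdist y| <= 1 * `|x - y|.
Proof.
have H z w : setdist z <= setdist w + `|z - w|.
  apply/ler_addgt0Pr => e e0.
  have [u Ku wu] : exists2 u, K u & `|w - u| < setdist w + e.
    by apply: setdist_lt; rewrite ltrDl.
  apply: le_trans (setdist_le z Ku) _; rewrite -(subrKA w z).
  by apply: le_trans (ler_normD _ _) _; rewrite addrC addrAC lerD2r ltW.
rewrite mul1r ler_norml; have := H x y; have := H y x; rewrite (distrC y x) => ? ?.
by apply/andP; split; lra.
Qed.

End SetDistance.

(** * Induction on the number of coordinates *)

Section Rademacher.
Variables (R : realType) (m : nat).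
Implicit Types (f : 'rV[R]_m -> R) (x h : 'rV[R]_m).

(* Differentiability along the span of the first j coordinate vectors. *)
Definition diff_upto (j : nat) f x : Prop :=
  exists a : 'rV[R]_m, forall eps, 0 < eps -> exists2 dl, 0 < dl &
    forall h, (forall i : 'I_m, (j <= i)%N -> h ord0 i = 0) -> `|h| < dl ->
      `|f (x + h) - f x - dotv a h| <= eps * `|h|.

(* On K p the difference quotients in direction e are uniformly close to a rational. The distance
   to K p is Lipschitz and minimal at a point x of K p, so its derivative vanishes there along the
   first j coordinates: x + h' is within o(h') of K p, where the bound in direction e applies. *)
Lemma diff_upto_step (j : 'I_m) f (L : R) :
  (forall x y, `|f x - f y| <= L * `|x - y|) ->
  (forall g (M : R), (forall x y, `|g x - g y| <= M * `|x - y|) ->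
     coord_null [set x | ~ diff_upto j g x]) ->
  coord_null [set x | ~ diff_upto j.+1 f x].
Proof.
move=> fL IH.
set e : 'rV[R]_m := delta_mx ord0 j.
(* [p.1.1] is an approximate slope, [p.1.2] fixes the tolerance and [p.2] the range of t. *)
pose K (p : rat * nat * nat) : set 'rV[R]_m := [set x | forall t, `|t| < p.2.+1%:R^-1 ->
  `|f (x + t *: e) - f x - ratr p.1.1 * t| <= p.1.2.+1%:R^-1 * `|t|].
pose E p := if pselect (K p !=set0) then [set x | ~ diff_upto j (setdist (K p)) x] else set0.
have nE : coord_null (\bigcup_p E p).
  apply: coord_null_countType => p; rewrite /E; case: pselect => K0.
    exact: IH (setdist_lipschitz K0).
  exact: coord_null0.
apply: coord_nullS (coord_nullU (coord_nullU (IH f L fL) (line_derivative_coord_null j fL)) nE).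
move=> x; apply: contra_notP => /not_orP[/not_orP[/contrapT [a Ha] /contrapT [al Hal]] nEx].
pose a' : 'rV[R]_m := \row_i if i == j then al else a ord0 i.
exists a' => eps eps0.
have eps4 : 0 < eps / 4 by rewrite divr_gt0.
have [q Hq] := exists_inv_lt eps4.
pose eta : R := q.+1%:R^-1 / 2.
have q0 : 0 < q.+1%:R^-1 :> R by rewrite invr_gt0 ltr0Sn.
have eta0 : 0 < eta by rewrite divr_gt0.
have [d1 d10 Hd1] := Hal _ eta0.
have [p Hp] := exists_inv_lt d10.
have [b /andP[b1 b2]] : exists b : rat, al - eta < ratr b < al + eta.
  have : al - eta < al + eta by rewrite ltrD2l gtrN.
  by move=> /rat_in_itvoo[b]; rewrite in_itv => Hb; exists b.
have bal : `|ratr b - al| <= eta by rewrite ler_norml; apply/andP; split; lra.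
have Kx : K (b, q, p) x.
  move=> t /= tp; have := Hd1 t (lt_trans tp Hp); rewrite add0r scale0r addr0 => H.
  have -> : f (x + t *: e) - f x - ratr b * t = (f (x + t *: e) - f x - al * t) - (ratr b - al) * t by ring.
  apply: le_trans (ler_normB _ _) _.
  have -> : q.+1%:R^-1 = eta + eta by rewrite /eta -splitr.
  by rewrite [leRHS]mulrDl lerD// normrM ler_wpM2r.
have K0 : K (b, q, p) !=set0 by exists x.
have [c Hc] : diff_upto j (setdist (K (b, q, p))) x.
  apply: contrapT => nd; apply: nEx; exists (b, q, p) => //.
  by rewrite /E; case: pselect.
(* Replacing x + h' by y costs 3 L eta' |h'| twice, with and without the step t e; the derivative
   along h' costs another eta' |h'|. *)
pose C := 6 * L + 1.
have L0 : 0 <= L.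
  by have := fL e 0; rewrite subr0 norm_delta_mx mulr1; apply: le_trans.
have C0 : 0 < C by rewrite /C; lra.
pose eta' := eps / 4 / C.
have eta'0 : 0 < eta' by rewrite divr_gt0.
have [d2 d20 Hd2] := Hc _ eta'0.
have [d3 d30 Hd3] := Ha _ eta'0.
exists (Num.min p.+1%:R^-1 (Num.min d2 d3)).
  by rewrite !lt_min invr_gt0 ltr0Sn d20.
move=> h h0; rewrite !lt_min => /and3P[hp hd2 hd3].
pose t := h ord0 j; pose h' := h - t *: e.
have hE : h = h' + t *: e by rewrite /h' subrK.
have th : `|t| <= `|h| by exact: mx_entry_norm.
have h'i i : h' ord0 i = if i == j then 0 else h ord0 i.
  by rewrite !mxE eqxx /=; case: eqP => [->|_]; rewrite ?mulr1 ?mulr0 ?subr0// subrr.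
have h'h : `|h'| <= `|h|.
  apply: mx_norm_ub => // k i; rewrite ord1 h'i; case: ifP => _; rewrite ?normr0//.
  exact: mx_entry_norm.
have h'0 (i : 'I_m) : (j <= i)%N -> h' ord0 i = 0.
  move=> ji; rewrite h'i; case: eqP => // /eqP ij; apply: h0.
  by rewrite ltn_neqAle ji andbT eq_sym.
have dotE : dotv a' h = dotv a h' + al * t.
  rewrite /dotv (bigD1 j)//= [in RHS](bigD1 j)//= h'i eqxx mulr0 add0r addrC mxE eqxx.
  congr (_ + _); apply: eq_bigr => i /negbTE ij; by rewrite h'i ij mxE ij.
(* The expansion at - h' and nonnegativity of the distance bound the linear term by eta' |h'|; the
   expansion at h' adds the second eta' |h'|. *)
have distx : setdist (K (b, q, p)) (x + h') <= 2 * eta' * `|h'|.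
  have := Hd2 h' h'0 (le_lt_trans h'h hd2).
  have := Hd2 (- h'); rewrite normrN => /(_ _ (le_lt_trans h'h hd2)) H2 H1.
  have {}H2 : `|setdist (K (b, q, p)) (x - h') - setdist (K (b, q, p)) x - dotv c (- h')| <= eta' * `|h'|.
    by apply: H2 => i ji; rewrite mxE h'0// oppr0.
  move: H1 H2; rewrite (setdist_in K0 Kx) dotvNr !subr0 !ler_norml.
  have := setdist_ge0 K0 (x - h').
  by move=> ? /andP[? ?] /andP[? ?]; lra.
(* The infimum need not be attained: the slack from 2 to 3 supplies y, except for h' = 0, where x
   itself serves. *)
have [y Ky xy] : exists2 y, K (b, q, p) y & `|x + h' - y| <= 3 * eta' * `|h'|.
  have [h'z|h'n] := eqVneq h' 0.
    by exists x => //; rewrite h'z addr0 subrr normr0 mulr0.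
  have : setdist (K (b, q, p)) (x + h') < 3 * eta' * `|h'|.
    apply: le_lt_trans distx _; rewrite ltr_pM2r ?normr_gt0// ltr_pM2r//.
    by rewrite ltr_nat.
  by move=> /(setdist_lt K0)[y Ky H]; exists y => //; exact: ltW.
have B1 : `|f (x + h) - f (y + t *: e)| <= L * (3 * eta' * `|h'|).
  apply: le_trans (fL _ _) _; rewrite ler_wpM2l//.
  by rewrite {1}hE addrA opprD addrACA subrr addr0.
have B2 := Ky t (le_lt_trans th hp).
have B3 : `|f (x + h') - f y| <= L * (3 * eta' * `|h'|).
  by apply: le_trans (fL _ _) _; rewrite ler_wpM2l.
have B4 := Hd3 h' h'0 (le_lt_trans h'h hd3).
have B5 : `|(ratr b - al) * t| <= eta * `|t| by rewrite normrM ler_wpM2r.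
have -> : f (x + h) - f x - dotv a' h =
  (f (x + h) - f (y + t *: e)) + (f (y + t *: e) - f y - ratr b * t) - (f (x + h') - f y)
  + (f (x + h') - f x - dotv a h') + (ratr b - al) * t by rewrite dotE; ring.
apply: le_trans (ler_normD _ _) _; apply: le_trans (lerD (ler_normD _ _) B5) _.
apply: le_trans (lerD (lerD (ler_normB _ _) B4) (lexx _)) _.
apply: le_trans (lerD (lerD (lerD (ler_normD _ _) B3) (lexx _)) (lexx _)) _.
apply: le_trans (lerD (lerD (lerD (lerD B1 B2) (lexx _)) (lexx _)) (lexx _)) _ => /=.
have E1 : eta' * C = eps / 4 by rewrite /eta' divfK// gt_eqF.
have E2 : eta * `|t| <= eps / 8 * `|h|.
  apply: ler_pM => //; first exact: ltW.
  by move: Hq; rewrite /eta; set u := _^-1 => Hq; lra.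
have E3 : q.+1%:R^-1 * `|t| <= eps / 4 * `|h| by apply: ler_pM => //; exact: ltW.
have E4 : eta' * C * `|h'| <= eps / 4 * `|h| by rewrite E1; apply: ler_pM => //; exact: ltW.
have h0' : 0 <= eps * `|h| by rewrite mulr_ge0// ltW.
move: E2 E3 E4; rewrite /C.
have -> : eta' * (6 * L + 1) * `|h'| = L * (3 * eta' * `|h'|) + L * (3 * eta' * `|h'|) + eta' * `|h'| by ring.
rewrite (mulrAC eps) (mulrAC eps (4^-1)); move: h0'.
move: (eps * `|h|) (eta * `|t|) (_^-1 * `|t|) (L * _) (eta' * `|h'|) => ? ? ? ? ? ? ? ? ?.
lra.
Qed.

Theorem rademacher f (L : R) : (forall x y, `|f x - f y| <= L * `|x - y|) ->
  coord_null [set x | ~ exists a : 'rV[R]_m, forall eps, 0 < eps -> exists2 dl, 0 < dl &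
    forall h, `|h| < dl -> `|f (x + h) - f x - dotv a h| <= eps * `|h|].
Proof.
move=> fL.
have H j : (j <= m)%N -> forall g (M : R), (forall x y, `|g x - g y| <= M * `|x - y|) ->
    coord_null [set x | ~ diff_upto j g x].
  elim: j => [_ g M gM|j IH jm g M gM].
    apply: (@coord_nullS _ _ _ set0); last exact: coord_null0.
    move=> x; apply; exists 0 => eps eps0; exists 1 => // h h0 _.
    have -> : h = 0 by apply/rowP => i; rewrite h0// mxE.
    by rewrite addr0 subrr dotv0r subr0 !normr0 mulr0.
  exact: (@diff_upto_step (Ordinal jm) g M gM (IH (ltnW jm))).
apply: coord_nullS (H m (leqnn m) f L fL) => x; apply: contra_not => -[a Ha].
exists a => eps /Ha[dl dl0 Hd]; exists dl => // h hd; apply: Hd => // i.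
by rewrite leqNgt ltn_ord.
Qed.

End Rademacher.

(** * Resolvents of convex subdifferentials *)

Section Cluster.
Variables (R : realType) (m : nat).

Lemma bounded_cluster (z : nat -> 'rV[R]_m) (M : R) : (forall k, `|z k| <= M) ->
  exists p, forall eps, 0 < eps -> forall N, exists2 k, (N <= k)%N & `|z k - p| < eps.
Proof.
move=> zM; pose K : set 'rV[R]_m := [set x | `|x| <= M].
have cK : compact K.
  apply: bounded_closed_compact.
    by exists M; split; [exact: num_real|move=> r /ltW Mr x /= /le_trans; apply].
  have cn : continuous (fun x : 'rV[R]_m => `|x|).
    by apply: (@lipschitz_cts _ _ _ 1) => x y; rewrite mul1r ler_dist_dist.
  apply: (@closed_comp _ _ (fun x : 'rV[R]_m => `|x|) [set r | r <= M]); last exact: closed_le.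
  by move=> x _; exact: cn.
have [|p [_ Hp]] := cK (z @ \oo) _; first by exists 0%N => // k _; exact: zM.
exists p => eps eps0 N.
have zN : (z @ \oo) [set z k | k in [set k | (N <= k)%N]] by exists N => // k Nk; exists k.
have [_ [[k Nk <-] pk]] := Hp _ _ zN (nbhsx_ballx p _ eps0).
by exists k => //; rewrite distrC; move: pk; rewrite -ball_normE.
Qed.

End Cluster.

(** Expansion of |u + v/2|^2 >= 0; the coefficient 1/4 leaves half of the quadratic term of the
    proximal objective. *)
Lemma dotv_young (R : realType) m (u v : 'rV[R]_m) :
  - dotv u u - dotv v v / 4 <= dotv u v.
Proof.
have := dotv_ge0 (2^-1 *: v + u).
rewrite dotvDl !dotvDr !dotvZl !dotvZr (dotvC v u) => ?; lra.
Qed.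

Section Prox.
Variables (R : realType) (m : nat) (g : 'rV[R]_m -> \bar R).

Lemma subdiff_monotone y ys z zs : subdiff g y ys -> subdiff g z zs ->
  0 <= dotv (y - z) (ys - zs).
Proof.
move=> [gy Hy] [gz Hz]; have := Hy z; have := Hz y.
rewrite -(fineK gy) -(fineK gz) -!EFinD !lee_fin.
rewrite !dotvBr !dotvBl !(dotvC _ ys) !(dotvC _ zs) => ? ?; lra.
Qed.

Hypotheses (gNy : forall y, g y != -oo%E) (glsc : lower_semicontinuous g)
  (gconv : convex_ext g).
Variables (yb ysb : 'rV[R]_m).
Hypothesis gyb : subdiff g yb ysb.

(** The point y minimises g + |. - u|^2 / 2. The subgradient at [yb] makes this objective coercive,
    a minimising sequence clusters, and lower semicontinuity makes the cluster point a minimiser;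
    convexity turns minimality into the inclusion. *)
Lemma resolvent_exists u : exists y, subdiff g y (u - y).
Proof.
pose q y := dotv (y - u) (y - u) / 2.
have [gb Hb] := gyb; set gb0 := fine (g yb).
pose c := gb0 + dotv ysb (u - yb) - dotv ysb ysb.
have lowb z : g z \is a fin_num -> c + dotv (z - u) (z - u) / 4 <= fine (g z) + q z.
  move=> gz; have H : gb0 + dotv ysb (z - yb) <= fine (g z).
    by rewrite -lee_fin EFinD !fineK//; exact: Hb.
  move: H; have -> : z - yb = (z - u) + (u - yb) by rewrite addrA subrK.
  rewrite dotvDr => H; have := dotv_young ysb (z - u).
  by rewrite /c /q; move: H; lra.
pose S : set R := [set r | exists2 z, g z \is a fin_num & r = fine (g z) + q z].
have hS : has_inf S.
  split; first by exists (gb0 + q yb), yb.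
  exists c => _ [z gz ->]; apply: le_trans (lowb z gz); rewrite lerDl.
  by rewrite divr_ge0// dotv_ge0.
set I := inf S.
have /choice[z Hz] : forall k : nat, exists z,
    g z \is a fin_num /\ fine (g z) + q z < I + k.+1%:R^-1.
  move=> k; have k0 : 0 < k.+1%:R^-1 :> R by rewrite invr_gt0.
  by have [_ [z gz ->] H] := inf_adherent k0 hS; exists z.
pose B := 4 * (I + 1 - c).
have zB k : `|z k| <= `|u| + (1 + B).
  have [gz Hk] := Hz k; have H1 := lowb _ gz.
  have k1 : k.+1%:R^-1 <= 1 :> R by rewrite invf_le1 ?ler1n.
  have H2 : dotv (z k - u) (z k - u) <= B by rewrite /B; move: Hk k1 H1; set w := _^-1; lra.
  have H3 := le_trans (norm_sqr_le_dotv (z k - u)) H2.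
  have -> : z k = u + (z k - u) by rewrite addrC subrK.
  apply: le_trans (ler_normD _ _) _; rewrite lerD2l.
  have := sqr_ge0 (`|z k - u| - 1); rewrite sqrrB expr1n; nra.
have [y Hy] := bounded_cluster zB.
have ybound z' : q y - m%:R * `|z' - y| * `|y - u| <= q z'.
  have -> : q z' = q y + dotv (z' - y) (y - u) + dotv (z' - y) (z' - y) / 2.
    rewrite /q; have -> : z' - u = (z' - y) + (y - u) by rewrite addrA subrK.
    move: (z' - y) (y - u) => a b.
    by rewrite dotvDl !dotvDr (dotvC b a); field.
  have := dotv_ge0 (z' - y); have := dotv_norm_le (z' - y) (y - u).
  by rewrite ler_norml => /andP[? _] ?; lra.
have gyI : (g y <= (I - q y)%:E)%E.
  apply/lee_addgt0Pr => e e0; rewrite -EFinD leNgt; apply/negP => /glsc [V].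
  move=> /nbhs_ballP[d /= d0 Vd] HV.
  pose C := m%:R * `|y - u| + 1.
  have C0 : 0 < C by rewrite ltr_wpDl// mulr_ge0.
  have e2 : 0 < e / 2 by rewrite divr_gt0.
  have [N HN] := exists_inv_lt e2.
  have d'0 : 0 < Num.min d (e / 2 / C) by rewrite lt_min d0 divr_gt0.
  have [k Nk] := Hy _ d'0 N; rewrite lt_min => /andP[kd kC].
  have /HV : V (z k) by apply: Vd; rewrite -ball_normE /= distrC.
  have [gz Hk] := Hz k; rewrite -(fineK gz) lte_fin => H1.
  have H2 := ybound (z k).
  have H3 : m%:R * `|z k - y| * `|y - u| <= e / 2.
    rewrite mulrAC; apply: (@le_trans _ _ (C * `|z k - y|)).
      by rewrite ler_wpM2r// /C lerDl.
    by rewrite -ler_pdivlMl// mulrC ltW.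
  have H4 : k.+1%:R^-1 <= N.+1%:R^-1 :> R by rewrite lef_pV2 ?posrE// ler_nat.
  move: H1 H2 H3 H4 HN Hk; move: (k.+1%:R^-1) (N.+1%:R^-1) => w w'; lra.
have gyf : g y \is a fin_num.
  rewrite fin_numE gNy /=; apply/eqP => gyy; move: gyI; rewrite gyy.
  by rewrite leye_eq.
have gyq : fine (g y) + q y <= I.
  by move: gyI; rewrite -(fineK gyf) lee_fin; lra.
have ymin z' : g z' \is a fin_num -> fine (g y) + q y <= fine (g z') + q z'.
  by move=> gz; apply: le_trans gyq _; apply: ge_inf; [exact: hS.2|exists z'].
exists y; split => // w.
have [->|gwy] := eqVneq (g w) +oo%E; first by rewrite leey.
have gwf : g w \is a fin_num by rewrite fin_numE gNy.
rewrite -(fineK gyf) -(fineK gwf) -EFinD lee_fin.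
(* Minimality is tested at t w + (1 - t) y and divided by t; the quadratic remainder keeps a factor
   t and vanishes as t tends to 0. *)
have Hlim t : 0 < t -> t <= 1 ->
    fine (g y) + dotv (u - y) (w - y) <= fine (g w) + t * (dotv (w - y) (w - y) / 2).
  move=> t0 t1; set v := t *: w + (1 - t) *: y.
  have := gconv w y (ltW t0) t1; rewrite -/v -(fineK gyf) -(fineK gwf) -!EFinM -EFinD => Hv.
  have gvf : g v \is a fin_num.
    by rewrite fin_numE gNy /=; apply/eqP => gvy; move: Hv; rewrite gvy leye_eq.
  move: Hv (ymin v gvf); rewrite -(fineK gvf) lee_fin /q.
  have -> : v - u = t *: (w - y) + (y - u).
    by rewrite /v scalerBl scale1r scalerBr; apply/rowP => i; rewrite !mxE; ring.
  have -> : dotv (u - y) (w - y) = - dotv (w - y) (y - u) by rewrite -(opprB y u) dotvNl dotvC.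
  move: (w - y) (y - u) => a b; rewrite dotvDl !dotvDr !dotvZl !dotvZr (dotvC b a) => H1 H2.
  rewrite -(ler_pM2l t0); lra.
apply/ler_addgt0Pr => e e0; pose N := dotv (w - y) (w - y) / 2 + 1.
have N0 : 0 < N by rewrite ltr_wpDl// divr_ge0// dotv_ge0.
pose t := Num.min 1 (e / N).
have t0 : 0 < t by rewrite lt_min ltr01 divr_gt0.
have t1 : t <= 1 by rewrite ge_min lexx.
apply: le_trans (Hlim t t0 t1) _; rewrite lerD2l.
apply: (@le_trans _ _ (t * N)); first by rewrite ler_pM2l// /N lerDl.
by rewrite -ler_pdivlMr// ge_min lexx orbT.
Qed.

End Prox.

(** * Convergence of matrices *)

Section MatrixSequences.
Variable R : realType.

(** Epsilon form of convergence; [tendsP] identifies it with the filter form that the SC derivative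
    uses. *)
Definition tends p q (z : nat -> 'M[R]_(p, q)) (l : 'M[R]_(p, q)) : Prop :=
  forall eps, 0 < eps -> exists N, forall k, (N <= k)%N -> `|z k - l| < eps.

Lemma mulmx_norm p q r (A : 'M[R]_(p, q)) (B : 'M[R]_(q, r)) :
  `|A *m B| <= q%:R * `|A| * `|B|.
Proof.
apply: mx_norm_ub => [|i j]; first by rewrite !mulr_ge0.
rewrite mxE; apply: le_trans (ler_norm_sum _ _ _) _.
apply: (@le_trans _ _ (\sum_(k < q) `|A| * `|B|)).
  by apply: ler_sum => k _; rewrite normrM ler_pM ?mx_entry_norm.
by rewrite sumr_const card_ord -mulrA mulr_natl.
Qed.

Lemma trmx_norm p q (A : 'M[R]_(p, q)) : `|A^T| = `|A|.
Proof.
by apply/le_anti/andP; split; apply: mx_norm_ub => // i j;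
  [rewrite mxE|rewrite -[A]trmxK mxE trmxK]; exact: mx_entry_norm.
Qed.

Lemma tends_cst p q (l : 'M[R]_(p, q)) : tends (fun=> l) l.
Proof. by move=> e e0; exists 0%N => k _; rewrite subrr normr0. Qed.

Lemma tends_sub p q (z w : nat -> 'M[R]_(p, q)) l l' :
  tends z l -> tends w l' -> tends (fun k => z k - w k) (l - l').
Proof.
move=> zl wl e e0; have e2 : 0 < e / 2 by rewrite divr_gt0.
have [N1 H1] := zl _ e2; have [N2 H2] := wl _ e2.
exists (maxn N1 N2) => k; rewrite geq_max => /andP[k1 k2].
have -> : z k - w k - (l - l') = (z k - l) - (w k - l').
  by rewrite !opprB addrACA [in RHS]addrACA; congr (_ + _); rewrite addrC.
by apply: le_lt_trans (ler_normB _ _) _; rewrite [e]splitr ltrD ?H1 ?H2.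
Qed.

Lemma tends_mulmx p q r (z : nat -> 'M[R]_(p, q)) (w : nat -> 'M[R]_(q, r)) l l' :
  tends z l -> tends w l' -> tends (fun k => z k *m w k) (l *m l').
Proof.
move=> zl wl e e0.
pose C : R := q%:R * (`|l'| + 1) + q%:R * `|l| + 1.
have C0 : 0 < C by rewrite ltr_wpDl// addr_ge0// mulr_ge0// addr_ge0.
have eC : 0 < e / C by rewrite divr_gt0.
have [N1 H1] := zl _ eC; have [N2 H2] := wl _ eC; have [N3 H3] := wl _ ltr01.
exists (maxn N1 (maxn N2 N3)) => k; rewrite !geq_max => /and3P[k1 k2 k3].
have {}H1 := H1 _ k1; have {}H2 := H2 _ k2; have {}H3 := H3 _ k3.
have -> : z k *m w k - l *m l' = (z k - l) *m w k + l *m (w k - l').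
  by rewrite mulmxBl mulmxBr addrA subrK.
apply: le_lt_trans (ler_normD _ _) _.
apply: le_lt_trans (lerD (mulmx_norm _ _) (mulmx_norm _ _)) _.
have wk : `|w k| <= `|l'| + 1.
  by rewrite -[w k](subrK l') addrC; apply: le_trans (ler_normD _ _) _; rewrite lerD2l ltW.
apply: (@le_lt_trans _ _ (q%:R * (e / C) * (`|l'| + 1) + q%:R * `|l| * (e / C))).
  rewrite lerD//; last by rewrite ler_wpM2l ?mulr_ge0// ltW.
  by rewrite ler_pM ?mulr_ge0// ler_wpM2l// ltW.
have -> : q%:R * (e / C) * (`|l'| + 1) + q%:R * `|l| * (e / C) = e / C * (C - 1).
  by rewrite /C; ring.
by rewrite mulrAC ltr_pdivrMr// ltr_pM2l// gtrDl ltrN10.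
Qed.

Lemma tends_trmx p q (z : nat -> 'M[R]_(p, q)) l : tends z l -> tends (fun k => (z k)^T) l^T.
Proof. by move=> zl e /zl[N H]; exists N => k /H; rewrite -linearB trmx_norm. Qed.

Lemma tends_unique p q (z : nat -> 'M[R]_(p, q)) l l' : tends z l -> tends z l' -> l = l'.
Proof.
move=> zl zl'; apply/eqP; rewrite -subr_eq0 -normr_eq0 eq_le normr_ge0 andbT.
apply/ler_addgt0Pr => e e0; rewrite add0r.
have e2 : 0 < e / 2 by rewrite divr_gt0.
have [N1 H1] := zl _ e2; have [N2 H2] := zl' _ e2.
have {}H1 := H1 (maxn N1 N2) (leq_maxl _ _).
have {}H2 := H2 (maxn N1 N2) (leq_maxr _ _).
rewrite -(subrKA (z (maxn N1 N2))) (splitr e); apply: le_trans (ler_normD _ _) _.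
by rewrite lerD// ltW// distrC.
Qed.

Lemma tends_subseq p q (z : nat -> 'M[R]_(p, q)) l (phi : nat -> nat) :
  (forall k, (k <= phi k)%N) -> tends z l -> tends (fun k => z (phi k)) l.
Proof. by move=> Hphi zl e /zl[N H]; exists N => k Nk; apply: H; exact: leq_trans (Hphi k). Qed.

Lemma tends_squeeze p q (z : nat -> 'M[R]_(p, q)) l (C : R) :
  (forall k, `|z k - l| <= C * k.+1%:R^-1) -> tends z l.
Proof.
move=> H e e0; have eC : 0 < e / (`|C| + 1) by rewrite divr_gt0 ?ltr_wpDl.
have [N HN] := exists_inv_lt eC; exists N => k Nk; apply: le_lt_trans (H k) _.
apply: (@le_lt_trans _ _ ((`|C| + 1) * N.+1%:R^-1)).
  apply: (@le_trans _ _ ((`|C| + 1) * k.+1%:R^-1)).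
    by rewrite ler_wpM2r ?invr_ge0// (le_trans (ler_norm _))// lerDl.
  by rewrite ler_wpM2l ?addr_ge0// lef_pV2 ?posrE// ler_nat.
by rewrite mulrC -ltr_pdivlMr// ltr_wpDl.
Qed.

(** The index map need not be increasing: k <= phi k is enough to carry limits along it. *)
Lemma bounded_extract p q (z : nat -> 'M[R]_(p, q)) (M : R) : (forall k, `|z k| <= M) ->
  exists2 phi : nat -> nat, (forall k, (k <= phi k)%N) &
    exists l, tends (fun k => z (phi k)) l.
Proof.
move=> zM.
have mxvec_norm (A : 'M[R]_(p, q)) : `|mxvec A| = `|A|.
  apply/le_anti/andP; split; apply: mx_norm_ub => // i j.
    by rewrite ord1; case/mxvec_indexP: j => k l; rewrite mxvecE; exact: mx_entry_norm.
  by rewrite -mxvecE; exact: mx_entry_norm.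
have [k|c Hc] := @bounded_cluster _ _ (fun k => mxvec (z k)) M; first by rewrite mxvec_norm.
have /choice[phi Hphi] : forall k : nat, exists j, (k <= j)%N /\ `|mxvec (z j) - c| < k.+1%:R^-1.
  by move=> k; have [|j kj zc] := Hc k.+1%:R^-1 _ k; [rewrite invr_gt0|exists j].
exists phi => [k|]; first exact: (Hphi k).1.
exists (vec_mx c); apply: (@tends_squeeze _ _ _ _ 1) => k.
by rewrite -mxvec_norm linearB /= vec_mxK mul1r ltW// (Hphi k).2.
Qed.

Lemma tendsP p q (z : nat -> 'M[R]_(p, q)) l : z @ \oo --> l <-> tends z l.
Proof.
split=> [/cvgrPdist_lt H e /H[N _ HN]|H]; first by exists N => k /HN; rewrite distrC.
by apply/cvgrPdist_lt => e /H[N HN]; exists N => // k /HN; rewrite distrC.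
Qed.

End MatrixSequences.

(** * Tangent subspaces *)

Lemma dotvE (R : realType) m (u v : 'rV[R]_m) : dotv u v = (u *m v^T) ord0 ord0.
Proof. by rewrite mxE; apply: eq_bigr => i _; rewrite mxE. Qed.

Lemma norm_dotv_squeeze (R : realType) m (u : 'rV[R]_m) r : 0 <= r ->
  dotv u u <= r ^+ 2 -> `|u| <= r.
Proof.
move=> r0 H; rewrite -ler_sqr ?nnegrE//.
exact: le_trans (norm_sqr_le_dotv u) H.
Qed.

Lemma tends_entry_ge0 (R : realType) p q (z : nat -> 'M[R]_(p, q)) l i j :
  tends z l -> (forall k, 0 <= z k i j) -> 0 <= l i j.
Proof.
move=> zl z0; apply/ler_addgt0Pr => e /zl[N HN].
have := le_lt_trans (mx_entry_norm _ i j) (HN N (leqnn N)).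
by rewrite !mxE ltr_norml => /andP[_]; have := z0 N; lra.
Qed.

Section RowSpan.
Variables (R : realType) (m : nat).
Implicit Types (B : 'M[R]_m) (Q : 'M[R]_(m + m)).

Definition span_mx B : 'M[R]_(m, m + m) := row_mx B (1%:M - B).

(** Adding the halves of (w B, w - w B) gives back w, so this is a common right inverse of all
    [span_mx B]; full row rank and invertible Gram matrices follow. *)
Definition sum_mx : 'M[R]_(m + m, m) := col_mx 1%:M 1%:M.

Lemma span_mx_sum B : span_mx B *m sum_mx = 1%:M.
Proof. by rewrite mul_row_col !mulmx1 addrC subrK. Qed.

Definition span_set B : set ('rV[R]_m * 'rV[R]_m) :=
  [set p | (pair_row p <= span_mx B)%MS].

Lemma span_setP B p : span_set B p <-> p.1 = (p.1 + p.2) *m B.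
Proof.
rewrite /span_set /= /pair_row /span_mx; split.
  move=> /submxP[D]; rewrite mul_mx_row => /eq_row_mx[-> ->].
  by rewrite mulmxBr mulmx1 addrC subrK.
move=> H; apply/submxP; exists (p.1 + p.2).
by rewrite mul_mx_row mulmxBr mulmx1 -H addrC addKr.
Qed.

Lemma span_set_dim B : subspace_of_dim m (span_set B).
Proof.
exists <<span_mx B>>%MS; rewrite mxrank_gen; split.
  apply/eqP; rewrite -/(row_free _); apply/row_freeP; exists sum_mx.
  exact: span_mx_sum.
by apply/funext => p; rewrite /= genmxE.
Qed.

(* Algebraic form of "Q is the orthogonal projection on span_set B", stable under limits. *)
Definition proj_eqs B Q : Prop :=
  Q = Q *m sum_mx *m span_mx B /\ (1%:M - Q) *m (span_mx B)^T = 0.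

Lemma proj_eqs_orth B Q : proj_eqs B Q -> is_orth_proj (span_set B) Q.
Proof.
move=> [Q1 Q2] v; split.
  rewrite /span_set /= /pair_row hsubmxK {1}Q1 !mulmxA; exact: submxMl.
move=> p /submxP[D ->]; rewrite dotvE trmx_mul mulmxA.
by rewrite -[v in v - _]mulmx1 -mulmxBr -(mulmxA v) Q2 mulmx0 mul0mx mxE.
Qed.

(** The projection is S^T (S S^T)^-1 S; the Gram matrix is invertible because S has a right
    inverse. *)
Lemma proj_eqs_exists B : exists Q, proj_eqs B Q.
Proof.
set S := span_mx B; pose G := S *m S^T.
have Gu : G \in unitmx.
  rewrite -row_free_unit -kermx_eq0; apply/eqP/row_matrixP => i; rewrite row0.
  set x := row i (kermx G); have xG : x *m G = 0 by rewrite -row_mul mulmx_ker row0.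
  have xS : x *m S = 0.
    apply: dotv_eq0; rewrite dotvE trmx_mul mulmxA -(mulmxA x) -/G xG.
    by rewrite mul0mx mxE.
  by rewrite -[x]mulmx1 -(span_mx_sum B) mulmxA xS mul0mx.
exists (S^T *m invmx G *m S); split.
  by rewrite -(mulmxA _ S) span_mx_sum mulmx1.
by rewrite mulmxBl mul1mx -(mulmxA _ S) -/G mulmxKV// subrr.
Qed.

Lemma norm_mx_contraction p q (A : 'M[R]_(p, q)) :
  (forall v, dotv (v *m A) (v *m A) <= dotv v v) -> `|A| <= 1.
Proof.
move=> H; apply: mx_norm_ub => // i j.
have -> : A i j = ((delta_mx ord0 i : 'rV_p) *m A) ord0 j.
  rewrite mxE (bigD1 i)//= mxE !eqxx mul1r big1 ?addr0// => k ki.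
  by rewrite mxE (negbTE ki) andbF mul0r.
apply: le_trans (mx_entry_norm _ _ _) _; apply: norm_dotv_squeeze => //.
apply: le_trans (H _) _; rewrite /dotv (bigD1 i)//= big1 ?addr0 => [|k ki].
  by rewrite mxE !eqxx mulr1 expr1n.
by rewrite mxE (negbTE ki) andbF mulr0.
Qed.

Lemma proj_eqs_norm B Q : proj_eqs B Q -> `|Q| <= 1.
Proof.
move=> HQ; apply: norm_mx_contraction => v.
have [H1 H2] := proj_eqs_orth HQ v; have := H2 _ H1.
rewrite /pair_row hsubmxK /= => H; have := dotv_ge0 (v - v *m Q).
move: H; rewrite dotvBl => /eqP; rewrite subr_eq0 => /eqP E.
by rewrite dotvBl !dotvBr (dotvC (v *m Q) v) E subrr subr0 subr_ge0.
Qed.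

Lemma tends_span_mx (z : nat -> 'M[R]_m) l : tends z l -> tends (fun k => span_mx (z k)) (span_mx l).
Proof.
move=> zl e /zl[N H]; exists N => k /H; apply: le_lt_trans.
apply: mx_norm_ub => // i j; rewrite /span_mx opp_row_mx add_row_mx.
case: (split_ordP j) => a ->; rewrite ?row_mxEl ?row_mxEr; first exact: mx_entry_norm.
have -> : 1%:M - z k - (1%:M - l) = - (z k - l).
  by rewrite !opprB addrC -addrA addKr.
by rewrite -[leRHS]normrN; exact: mx_entry_norm.
Qed.

Lemma proj_eqs_lim (z : nat -> 'M[R]_m) (w : nat -> 'M[R]_(m + m)) B Q :
  tends z B -> tends w Q -> (forall k, proj_eqs (z k) (w k)) -> proj_eqs B Q.
Proof.
move=> zB wQ H; have sB := tends_span_mx zB; split.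
  apply: (tends_unique wQ).
  have := tends_mulmx (tends_mulmx wQ (tends_cst sum_mx)) sB.
  by move=> K e /K[N HN]; exists N => k /HN; rewrite -(H k).1.
have := tends_mulmx (tends_sub (tends_cst 1%:M) wQ) (tends_trmx sB).
move=> K; apply: (tends_unique K).
by move=> e e0; exists 0%N => k _; rewrite (H k).2 subrr normr0.
Qed.

End RowSpan.

Section Resolvent.
Variables (R : realType) (m : nat) (g : 'rV[R]_m -> \bar R) (P : 'rV[R]_m -> 'rV[R]_m).
Hypothesis Pg : forall u, subdiff g (P u) (u - P u).

Lemma resolvent_firm u v : dotv (P u - P v) (P u - P v) <= dotv (P u - P v) (u - v).
Proof.
have := subdiff_monotone (Pg u) (Pg v).
have -> : u - P u - (v - P v) = (u - v) - (P u - P v).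
  by apply/rowP => i; rewrite !mxE; ring.
by rewrite dotvBr subr_ge0.
Qed.

(** Monotonicity leaves a single y with u - y in the subdifferential at y, so membership in the
    graph becomes an equation for P. *)
Lemma resolvent_graph y ys : subdiff g y ys <-> P (y + ys) = y.
Proof.
split=> [gy|Py]; last by have := Pg (y + ys); rewrite Py addrAC subrr add0r.
apply/eqP; rewrite -subr_eq0; apply/eqP/dotv_eq0.
have := subdiff_monotone (Pg (y + ys)) gy.
have -> : y + ys - P (y + ys) - ys = - (P (y + ys) - y).
  by apply/rowP => i; rewrite !mxE; ring.
by rewrite dotvNr oppr_ge0.
Qed.

Lemma resolvent_lipschitz u v : `|P u - P v| <= m%:R * `|u - v|.
Proof.
have [->|n0] := eqVneq (P u - P v) 0; first by rewrite normr0 mulr_ge0.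
have : `|P u - P v| ^+ 2 <= m%:R * `|P u - P v| * `|u - v|.
  apply: le_trans (norm_sqr_le_dotv _) _; apply: le_trans (resolvent_firm u v) _.
  exact: le_trans (ler_norm _) (dotv_norm_le _ _).
by rewrite expr2 (mulrC m%:R) -mulrA ler_pM2l// normr_gt0.
Qed.

Definition has_jac u (B : 'M[R]_m) : Prop :=
  forall eps, 0 < eps -> exists2 dl, 0 < dl &
    forall h, `|h| < dl -> `|P (u + h) - P u - h *m B| <= eps * `|h|.

(** The directions [h k] vary because the contingent cone is defined by convergent sequences of
    directions. *)
Lemma has_jac_tends u B (h : nat -> 'rV[R]_m) c (t : nat -> R) :
  has_jac u B -> (forall k, 0 < t k) -> t @ \oo --> (0 : R) -> tends h c ->
  tends (fun k => (t k)^-1 *: (P (u + t k *: h k) - P u)) (c *m B).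
Proof.
move=> HB t0 tl hc e e0.
have e2 : 0 < e / 2 by rewrite divr_gt0.
have C0 : 0 < `|c| + 1 by rewrite ltr_wpDl.
have eC : 0 < e / 2 / (`|c| + 1) by rewrite divr_gt0.
have [dl dl0 Hd] := HB _ eC.
have [N1 H1] := hc _ ltr01.
have [N2 H2] := tends_mulmx hc (tends_cst B) e2.
have dC : 0 < dl / (`|c| + 1) by rewrite divr_gt0.
have /cvgrPdist_lt/(_ _ dC)[N3 _ H3] := tl.
exists (maxn N1 (maxn N2 N3)) => k; rewrite !geq_max => /and3P[k1 k2 k3].
have hk : `|h k| <= `|c| + 1.
  by rewrite -[h k](subrK c) addrC; apply: le_trans (ler_normD _ _) _; rewrite lerD2l ltW ?H1.
have tk : t k < dl / (`|c| + 1).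
  by have := H3 k k3; rewrite /= sub0r normrN gtr0_norm.
have thk : `|t k *: h k| = t k * `|h k| by rewrite normrZ gtr0_norm.
have thd : `|t k *: h k| < dl.
  rewrite thk; apply: (@le_lt_trans _ _ (t k * (`|c| + 1))); first by rewrite ler_pM2l.
  by rewrite -ltr_pdivlMr.
have := Hd _ thd; rewrite thk => H.
have -> : (t k)^-1 *: (P (u + t k *: h k) - P u) - c *m B =
    (t k)^-1 *: (P (u + t k *: h k) - P u - (t k *: h k) *m B) + (h k *m B - c *m B).
  by rewrite [in RHS]scalerBr -scalemxAl scalerK ?gt_eqF// addrA subrK.
apply: le_lt_trans (ler_normD _ _) _; rewrite (splitr e) ler_ltD ?H2//.
rewrite normrZ gtr0_norm ?invr_gt0// ler_pdivrMl//.
apply: le_trans H _; rewrite mulrCA ler_pM2l//.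
by rewrite mulrAC ler_pdivrMr// ler_pM2l.
Qed.

Lemma harmonic_tends0 : (fun k : nat => k.+1%:R^-1 : R) @ \oo --> (0 : R).
Proof. exact: cvg_harmonic. Qed.

Lemma has_jac_firm u B v : has_jac u B -> dotv (v *m B) (v *m B) <= dotv (v *m B) v.
Proof.
move=> HB; have t0 (k : nat) : 0 < k.+1%:R^-1 :> R by rewrite invr_gt0.
have H := has_jac_tends HB t0 harmonic_tends0 (tends_cst v).
set z := (fun k => _) in H.
have Hz k : dotv (z k) (z k) <= dotv (z k) v.
  rewrite /z dotvZl dotvZr dotvZl ler_pM2l ?invr_gt0 ?invr_gt0//.
  have := resolvent_firm (u + k.+1%:R^-1 *: v) u.
  by rewrite -[u + _ - u]addrAC subrr add0r dotvZr -ler_pdivrMl.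
have K := tends_mulmx H (tends_sub (tends_trmx (tends_cst v)) (tends_trmx H)).
rewrite -subr_ge0.
have dE (a : 'rV[R]_m) : dotv a v - dotv a a = (a *m (v^T - a^T)) ord0 ord0.
  by rewrite -dotvBr dotvE linearB.
rewrite dE; apply: (tends_entry_ge0 K) => k.
by rewrite -dE subr_ge0.
Qed.

Lemma has_jac_norm u B : has_jac u B -> `|B| <= 1.
Proof.
move=> HB; apply: norm_mx_contraction => v; have H := has_jac_firm v HB.
have := dotv_ge0 (v - v *m B); rewrite dotvBl !dotvBr (dotvC v (v *m B)); lra.
Qed.

(** Moving in the graph by (t a, t b) moves the parameter u by t (a + b), so limits satisfy a = (a +
    b) B; conversely the difference quotients of P realise every such pair. *)
Lemma tangent_cone_has_jac u B : has_jac u B ->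
  tangent_cone (gph_subdiff g) (P u, u - P u) = span_set B.
Proof.
move=> HB; apply/seteqP; split => [w|w /span_setP wE] /=.
  move=> [t [a [b [t0 [tl [/tendsP al [/tendsP bl H]]]]]]]; apply/span_setP.
  have abl : tends (fun k => a k + b k) (w.1 + w.2).
    move=> e /(tends_sub al (tends_sub (tends_cst 0) bl))[N HN]; exists N => k /HN.
    by rewrite !sub0r !opprK.
  apply: (tends_unique al) => e e0.
  have [N HN] := has_jac_tends HB t0 tl abl e0; exists N => k /HN.
  suff -> : P (u + t k *: (a k + b k)) = P u + t k *: a k.
    by rewrite addrAC subrr add0r scalerK// gt_eqF.
  have /resolvent_graph /= Hk := H k; rewrite -[RHS]Hk; congr P; rewrite scalerDr.
  by apply/rowP => i; rewrite !mxE; ring.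
pose c := w.1 + w.2.
have t0 (k : nat) : 0 < k.+1%:R^-1 :> R by rewrite invr_gt0.
have H := has_jac_tends HB t0 harmonic_tends0 (tends_cst c).
set z := (fun k => _) in H.
have Pz k : P u + k.+1%:R^-1 *: z k = P (u + k.+1%:R^-1 *: c).
  by rewrite /z scalerA mulfV ?scale1r 1?addrC ?subrK// invr_eq0 pnatr_eq0.
exists (fun k => k.+1%:R^-1), z, (fun k => c - z k).
split; first exact: t0.
split; first exact: harmonic_tends0.
split; first by apply/tendsP; rewrite wE.
split.
  apply/tendsP; have := tends_sub (tends_cst c) H.
  by rewrite -wE /c addrAC subrr add0r.
move=> k; apply/resolvent_graph => /=; rewrite Pz; congr P.
rewrite scalerBr -[in LHS](addrA u) -/c.
by rewrite -Pz; apply/rowP => i; rewrite !mxE; ring.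
Qed.

End Resolvent.

(** * Coercivity and mean values *)

Lemma has_der_unique (R : realType) (f : R -> R) x d d' :
  has_der f x d -> has_der f x d' -> d = d'.
Proof.
move=> H H'; apply/eqP; rewrite -subr_eq0 -normr_eq0 eq_le normr_ge0 andbT.
apply/ler_addgt0Pr => e e0; rewrite add0r.
have e2 : 0 < e / 2 by rewrite divr_gt0.
have [a a0 Ha] := H _ e2; have [b b0 Hb] := H' _ e2.
pose t := Num.min a b / 2.
have t0 : 0 < t by rewrite divr_gt0// lt_min a0.
have [ta tb] : `|t| < a /\ `|t| < b.
  have : t < Num.min a b by rewrite /t ltr_pdivrMr// ltr_pMr ?lt_min ?a0// ltr1n.
  by rewrite gtr0_norm// lt_min => /andP[].
have := lerD (Ha _ ta) (Hb _ tb); rewrite -mulrDl -splitr.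
move/(le_trans (ler_normB _ _)).
have -> : f (x + t) - f x - d * t - (f (x + t) - f x - d' * t) = - ((d - d') * t) by ring.
by rewrite normrN normrM ler_pM2r// normr_gt0 gt_eqF.
Qed.

Section Coercivity.
Variables (R : realType) (n m : nat) (F : 'rV[R]_n -> 'rV[R]_m) (g : 'rV[R]_m -> \bar R).
Variables (xb : 'rV[R]_n) (ysb : 'rV[R]_m) (P : 'rV[R]_m -> 'rV[R]_m).
Hypothesis Pg : forall u, subdiff g (P u) (u - P u).
Hypothesis gb : subdiff g (F xb) ysb.
Hypothesis soqc : SOQC F g xb ysb.
Local Notation ub := (F xb + ysb).
Local Notation adj := (adjF F xb).

Lemma adjF_lim (w : nat -> 'rV[R]_m) v : tends w v -> tends (fun k => adj (w k)) (adj v).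
Proof. by move=> wv; exact: tends_mulmx wv (tends_cst _). Qed.

(* Otherwise normalised directions v and derivatives B converge along a sequence to a limit with
   v *m B = 0 and adj v = 0, so (0, v) lies in the limit subspace and SOQC gives v = 0. *)
Lemma resolvent_coercive_deriv : exists c r, [/\ 0 < c, 0 < r &
  forall u B v, `|u - ub| < r -> has_jac P u B ->
    c * dotv v v <= dotv v (v *m B) + dotv (adj v) (adj v)].
Proof.
apply: contrapT => nex.
(* The components are u, B, the normalised v and the projection matrix for B. A unit vector in the
   maximum norm has <v, v> <= m, whence the factor m. *)
have /choice[z Hz] : forall k : nat, exists z : 'rV[R]_m * 'M[R]_m * 'rV[R]_m * 'M[R]_(m + m),
    [/\ `|z.1.1.1 - ub| < k.+1%:R^-1, has_jac P z.1.1.1 z.1.1.2, `|z.1.2| = 1,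
        dotv z.1.2 (z.1.2 *m z.1.1.2) + dotv (adj z.1.2) (adj z.1.2) <= m%:R * k.+1%:R^-1 &
        proj_eqs z.1.1.2 z.2].
  move=> k; apply: contrapT => nz; apply: nex; exists k.+1%:R^-1, k.+1%:R^-1.
  split; [by rewrite invr_gt0|by rewrite invr_gt0|].
  move=> u B v uk HB; rewrite leNgt; apply/negP => lt; apply: nz.
  have [Q HQ] := proj_eqs_exists B.
  have v0 : v != 0.
    apply/eqP => v0; move: lt; rewrite v0 /adjF !mul0mx !dotv0l mulr0 addr0.
    by rewrite ltxx.
  have nv0 : 0 < `|v| by rewrite normr_gt0.
  exists (u, B, `|v|^-1 *: v, Q); split => //=.
    by rewrite normrZ normfV normr_id mulVf// gt_eqF.
  have S : `|v|^-1 * (`|v|^-1 * dotv v v) <= m%:R.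
    rewrite !ler_pdivrMl// mulrA [leRHS]mulrC mulrA.
    exact: le_trans (ler_norm _) (dotv_norm_le _ _).
  rewrite /adjF -!scalemxAl !(dotvZl, dotvZr) -!mulrDr.
  apply: (@le_trans _ _ (`|v|^-1 * (`|v|^-1 * (k.+1%:R^-1 * dotv v v)))).
    by rewrite !ler_pM2l ?invr_gt0// ltW.
  have cm (a b d : R) : a * (a * (b * d)) = a * (a * d) * b by ring.
  by rewrite cm ler_pM2r ?invr_gt0.
have B1 k : `|(z k).1.1.2| <= 1 by have [_ H _ _ _] := Hz k; exact: has_jac_norm H.
have Q1 k : `|(z k).2| <= 1 by have [_ _ _ _ H] := Hz k; exact: proj_eqs_norm H.
have w1 k : `|(z k).1.2| <= 1 by have [_ _ -> _ _] := Hz k.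
have [p1 p1le [B lB]] := bounded_extract B1.
have [p2 p2le [v lv]] := @bounded_extract _ _ _ (fun k => (z (p1 k)).1.2) 1 (fun k => w1 (p1 k)).
have [p3 p3le [Q lQ]] :=
  @bounded_extract _ _ _ (fun k => (z (p1 (p2 k))).2) 1 (fun k => Q1 (p1 (p2 k))).
pose p k := p1 (p2 (p3 k)).
have ple k : (k <= p k)%N.
  by apply: leq_trans (p3le k) _; apply: leq_trans (p2le _) _; exact: p1le.
have {}lB : tends (fun k => (z (p k)).1.1.2) B.
  apply: (@tends_subseq _ _ _ (fun k => (z (p1 k)).1.1.2) B (fun k => p2 (p3 k))) => // k.
  by apply: leq_trans (p3le k) _; exact: p2le.
have {}lv : tends (fun k => (z (p k)).1.2) v.
  exact: (@tends_subseq _ _ _ (fun k => (z (p1 (p2 k))).1.2) v p3).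
have {}Hz k := Hz (p k).
have pinv k : (p k).+1%:R^-1 <= k.+1%:R^-1 :> R.
  by rewrite lef_pV2 ?posrE// ler_nat ltnS.
have lu : tends (fun k => (z (p k)).1.1.1) ub.
  apply: (@tends_squeeze _ _ _ _ _ 1) => k; rewrite mul1r.
  by have [H _ _ _ _] := Hz k; apply: le_trans (ltW H) _.
(* By firm nonexpansiveness |v B|^2 is at most <v, v B>, so both summands are squares forced to
   0. *)
have small k : dotv ((z (p k)).1.2 *m (z (p k)).1.1.2) ((z (p k)).1.2 *m (z (p k)).1.1.2) +
    dotv (adj (z (p k)).1.2) (adj (z (p k)).1.2) <= m%:R * k.+1%:R^-1.
  have [_ HB _ H _] := Hz k; apply: le_trans (le_trans H _); last by rewrite ler_wpM2l.
  by rewrite lerD2r (dotvC (z (p k)).1.2); exact: has_jac_firm HB.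
have sqr_lim (q : nat) (y : nat -> 'rV[R]_q) l : tends y l ->
    (forall k, dotv (y k) (y k) <= m%:R * k.+1%:R^-1) -> l = 0.
  move=> yl H; apply: (tends_unique yl) => e e0.
  have e2 : 0 < e ^+ 2 / (m%:R + 1) by rewrite divr_gt0 ?exprn_gt0// ltr_wpDl.
  have [N HN] := exists_inv_lt e2; exists N => k Nk; rewrite subr0.
  rewrite -ltr_sqr ?nnegrE//; last exact: ltW.
  apply: le_lt_trans (norm_sqr_le_dotv _) _.
  apply: le_lt_trans (H k) _; apply: (@le_lt_trans _ _ ((m%:R + 1) * N.+1%:R^-1)).
    by rewrite ler_pM ?lerDl// lef_pV2 ?posrE// ler_nat.
  by rewrite mulrC -ltr_pdivlMr// ltr_wpDl.
have vB : v *m B = 0.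
  apply: (sqr_lim _ _ _ (tends_mulmx lv lB)) => k.
  by apply: le_trans (small k); rewrite lerDl dotv_ge0.
have vJ : adj v = 0.
  apply: (sqr_lim _ _ _ (adjF_lim lv)) => k.
  by apply: le_trans (small k); rewrite lerDr dotv_ge0.
have HQ : proj_eqs B Q by apply: (proj_eqs_lim lB lQ) => k; have [] := Hz k.
have Pub : P ub = F xb by exact/(resolvent_graph Pg).
have lP : tends (fun k => P (z (p k)).1.1.1) (F xb).
  rewrite -Pub; apply: (@tends_squeeze _ _ _ _ _ m%:R) => k.
  apply: le_trans (resolvent_lipschitz Pg _ _) _; rewrite ler_wpM2l//.
  by have [H _ _ _ _] := Hz k; apply: le_trans (ltW H) _.
have SB : SC_deriv g (F xb) ysb (span_set B).
  split; first exact: span_set_dim.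
  exists (fun k => P (z (p k)).1.1.1), (fun k => (z (p k)).1.1.1 - P (z (p k)).1.1.1),
    (fun k => (z (p k)).2), Q.
  have tc k : tangent_cone (gph_subdiff g)
      (P (z (p k)).1.1.1, (z (p k)).1.1.1 - P (z (p k)).1.1.1) = span_set (z (p k)).1.1.2.
    by apply: tangent_cone_has_jac => //; have [] := Hz k.
  split; first by move=> k; split; [exact: Pg|rewrite tc; exact: span_set_dim].
  split; first exact/tendsP.
  split.
    by apply/tendsP; have := tends_sub lu lP; rewrite addrAC subrr add0r.
  split; first by move=> k; rewrite tc; apply: proj_eqs_orth; have [] := Hz k.
  split; first exact: proj_eqs_orth.
  apply/cvgrPdist_lt => e /lQ[N HN]; exists N => // k /HN.
  by rewrite sub0r normrN normr_id.
have v0 : v = 0.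
  apply: (soqc SB vJ); apply/span_setP => /=; by rewrite add0r vB.
have [N HN] := lv _ ltr01; have := HN N (leqnn N).
by have [_ _ w1' _ _] := Hz N; rewrite v0 subr0 w1' ltxx.
Qed.

End Coercivity.

Section MeanValue.
Variables (R : realType) (m : nat) (g : 'rV[R]_m -> \bar R) (P : 'rV[R]_m -> 'rV[R]_m).
Hypothesis Pg : forall u, subdiff g (P u) (u - P u).

Lemma resolvent_ae_has_jac : coord_null [set x | ~ exists B, has_jac P x B].
Proof.
pose D i x (a : 'rV[R]_m) := forall eps, 0 < eps -> exists2 dl, 0 < dl &
    forall h, `|h| < dl -> `|P (x + h) ord0 i - P x ord0 i - dotv a h| <= eps * `|h|.
have H : coord_null (\bigcup_i [set x | ~ exists a, D i x a]).
  apply: coord_null_countType => i; apply: (@rademacher _ _ (fun x => P x ord0 i) m%:R) => x y.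
  apply: le_trans (resolvent_lipschitz Pg x y).
  by have := mx_entry_norm (P x - P y) ord0 i; rewrite !mxE.
apply: coord_nullS H => x; apply: contra_notP => nx.
have /choice[a Ha] : forall i, exists a, D i x a.
  by move=> i; apply: contrapT => na; apply: nx; exists i.
exists (\matrix_(k, i) a i ord0 k) => eps eps0.
have /choice[dl Hdl] : forall i, exists dl, 0 < dl /\ forall h, `|h| < dl ->
    `|P (x + h) ord0 i - P x ord0 i - dotv (a i) h| <= eps * `|h|.
  by move=> i; have [dl dl0 Hd] := Ha i _ eps0; exists dl.
exists (\big[Num.min/1]_(i < m) dl i).
  by apply: (big_ind (fun r => 0 < r)) => // [r s r0 s0|i _]; [rewrite lt_min r0|exact: (Hdl i).1].
move=> h hd; apply: mx_norm_ub => [|k i]; first by rewrite mulr_ge0// ltW.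
rewrite (ord1 k) !mxE (_ : \sum_j _ = dotv (a i) h); last first.
  by apply: eq_bigr => j _; rewrite mxE mulrC.
apply: (Hdl i).2; apply: lt_le_trans hd _.
exact: bigmin_le_cond.
Qed.

(** The segment from u' to u may itself lie in the exceptional set; [rho] is the room for shifting
    it inside C. *)
Lemma resolvent_mean_value (C : set 'rV[R]_m) (u u' : 'rV[R]_m) (rho ga : R) :
  0 < rho ->
  (forall x t, `|x - u'| < rho -> 0 < t < 1 -> C (x + t *: (u - u'))) ->
  (forall x B, C x -> has_jac P x B -> ga <= dotv (u - u') ((u - u') *m B)) ->
  ga <= dotv (u - u') (P u - P u').
Proof.
move=> rho0 HC Hga; set D := u - u'.
apply/ler_addgt0Pr => e e0.
(* One factor m comes from the inner product bound, the other from the Lipschitz constant of P; [rh]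
   keeps the two endpoint errors M rh together below e. *)
pose M : R := m%:R * `|D| * m%:R.
have M0 : 0 <= M by rewrite !mulr_ge0.
pose rh := Num.min rho (e / (M + M + 1)).
have rh0 : 0 < rh by rewrite lt_min rho0 divr_gt0// ltr_wpDl// addr_ge0.
have u'U : ball u' rh !=set0 by exists u'; exact: ballxx.
have [x xU xae] := coord_null_transversal D resolvent_ae_has_jac (ball_open u' rh) u'U.
have {}xU : `|x - u'| < rh by rewrite distrC; move: xU; rewrite -ball_normE.
pose phi (t : R) := dotv D (P (x + t *: D)).
have phi_lip s t : `|phi s - phi t| <= M * `|D| * `|s - t|.
  rewrite /phi -dotvBr; apply: le_trans (dotv_norm_le _ _) _; rewrite /M -!mulrA.
  rewrite !ler_wpM2l//; apply: le_trans (resolvent_lipschitz Pg _ _) _.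
  rewrite ler_wpM2l// opprD addrACA subrr add0r -scalerBl normrZ mulrC.
  exact: lexx.
have phi_ae : ga * (1 - 0) <= phi 1 - phi 0.
  apply: (lipschitz_ae_ge phi_lip ltr01).
  apply: filterS xae; first exact: (ae_filter_ringOfSetsType (@lebesgue_measure R)).
  move=> t /contrapT[B HB] t0 t1 d Hd.
  suff HdB : has_der phi t (dotv D (D *m B)).
    rewrite (has_der_unique Hd HdB); apply: Hga HB; apply: HC.
      by move: xU; rewrite lt_min => /andP[].
    by rewrite t0.
  move=> eps eps0.
  have N0 : 0 < m%:R * `|D| * `|D| + 1 by rewrite ltr_wpDl// !mulr_ge0.
  have eN : 0 < eps / (m%:R * `|D| * `|D| + 1) by rewrite divr_gt0.
  have [dl dl0 Hdl] := HB _ eN.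
  have D1 : 0 < `|D| + 1 by rewrite ltr_wpDl.
  exists (dl / (`|D| + 1)) => [|s sd]; first by rewrite divr_gt0.
  have sD : `|s *: D| < dl.
    rewrite normrZ; apply: (@le_lt_trans _ _ (`|s| * (`|D| + 1))).
      by rewrite ler_wpM2l// lerDl.
    by rewrite -ltr_pdivlMr.
  have := Hdl _ sD; rewrite -(addrA x) -scalerDl normrZ => H.
  have -> : phi (t + s) - phi t - dotv D (D *m B) * s =
      dotv D (P (x + (t + s) *: D) - P (x + t *: D) - (s *: D) *m B).
    by rewrite -scalemxAl !dotvBr dotvZr mulrC.
  apply: le_trans (dotv_norm_le _ _) _.
  apply: (@le_trans _ _ (m%:R * `|D| * (eps / (m%:R * `|D| * `|D| + 1) * (`|s| * `|D|)))).
    by rewrite ler_wpM2l// mulr_ge0.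
  have -> : m%:R * `|D| * (eps / (m%:R * `|D| * `|D| + 1) * (`|s| * `|D|)) =
     (eps * `|s|) * ((m%:R * `|D| * `|D|) / (m%:R * `|D| * `|D| + 1)).
    by ring.
  apply: ler_piMr; first by rewrite mulr_ge0// ltW.
  by rewrite ler_pdivrMr// mul1r lerDl.
have E1 : `|phi 1 - dotv D (P u)| <= M * rh.
  rewrite /phi scale1r -dotvBr; apply: le_trans (dotv_norm_le _ _) _.
  rewrite /M -!mulrA !ler_wpM2l//; apply: le_trans (resolvent_lipschitz Pg _ _) _.
  rewrite ler_wpM2l// (_ : x + D - u = x - u') ?ltW//.
  by apply/rowP => i; rewrite /D !mxE; ring.
have E2 : `|phi 0 - dotv D (P u')| <= M * rh.
  rewrite /phi scale0r addr0 -dotvBr; apply: le_trans (dotv_norm_le _ _) _.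
  rewrite /M -!mulrA !ler_wpM2l//; apply: le_trans (resolvent_lipschitz Pg _ _) _.
  by rewrite ler_wpM2l// ltW.
have E3 : M * rh + M * rh <= e.
  rewrite -mulrDl; apply: (@le_trans _ _ ((M + M + 1) * rh)).
    by rewrite ler_wpM2r ?lerDl// ltW.
  by rewrite -ler_pdivlMl ?ltr_wpDl ?addr_ge0// ge_min [e / _]mulrC lexx orbT.
rewrite dotvBr; move: E1 E2 phi_ae; rewrite !ler_norml => /andP[? ?] /andP[? ?] ?; lra.
Qed.

End MeanValue.

(** * Local Lipschitz estimate *)

Section SmoothMap.
Variables (R : realType) (n m : nat) (F : 'rV[R]_n -> 'rV[R]_m).

Lemma differentiable_jac x : differentiable F x -> forall eps, 0 < eps ->
  exists2 dl, 0 < dl & forall h, `|h| < dl ->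
    `|F (x + h) - F x - h *m jac F x| <= eps * `|h|.
Proof.
move=> /diff_locallyP[_ /eqaddoP HF] eps eps0.
have /nbhs_ballP[dl /= dl0 Hd] := HF _ eps0.
exists dl => // h hd; have := Hd h.
rewrite -ball_normE /= sub0r normrN => /(_ hd).
by rewrite !fctE /= [h + x]addrC /jac mul_rV_lin1 opprD addrA.
Qed.

Lemma has_der_derive (f : R -> R) x d : has_der f x d -> is_derive x 1 f d.
Proof.
move=> H; have cv : h^-1 *: ((f \o shift x) (h *: 1) - f x) @[h --> 0^'] --> d.
  apply/cvgrPdist_le => e e0; have [dl dl0 Hd] := H _ e0.
  exists dl => // t; rewrite /= sub0r normrN => td t0; have := Hd t td.
  rewrite [t *: 1]mulr1 [x + t]addrC => Ht.
  have -> : d - t^-1 *: (f (t + x) - f x) = - (f (t + x) - f x - d * t) / t.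
    by rewrite /GRing.scale /=; field.
  by rewrite normrM normrN normfV ler_pdivrMr ?normr_gt0.
split; first by apply/cvg_ex; exists d.
exact: cvg_lim cv.
Qed.

(** In the maximum norm the one-variable mean value theorem can be used entry by entry, each entry
    with its own intermediate point. *)
Lemma mean_value_bound (x1 x2 : 'rV[R]_n) (K : R) : 0 <= K ->
  (forall t, 0 <= t <= 1 -> differentiable F (x2 + t *: (x1 - x2))) ->
  (forall t, 0 <= t <= 1 -> `|jac F (x2 + t *: (x1 - x2))| <= K) ->
  `|F x1 - F x2| <= n%:R * K * `|x1 - x2|.
Proof.
move=> K0 dF JK; set D := x1 - x2; apply: mx_norm_ub => [|k i]; first by rewrite !mulr_ge0.
pose phi (t : R) := F (x2 + t *: D) k i.
pose dphi (t : R) := (D *m jac F (x2 + t *: D)) k i.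
have Hder t : 0 <= t <= 1 -> has_der phi t (dphi t).
  move=> t01 eps eps0; have D1 : 0 < `|D| + 1 by rewrite ltr_wpDl.
  have eD : 0 < eps / (`|D| + 1) by rewrite divr_gt0.
  have [dl dl0 Hd] := differentiable_jac (dF t t01) eD.
  exists (dl / (`|D| + 1)) => [|s sd]; first by rewrite divr_gt0.
  have sD : `|s *: D| < dl.
    rewrite normrZ; apply: (@le_lt_trans _ _ (`|s| * (`|D| + 1))).
      by rewrite ler_wpM2l// lerDl.
    by rewrite -ltr_pdivlMr.
  have := Hd _ sD; rewrite -(addrA x2) -scalerDl normrZ => H.
  have -> : phi (t + s) - phi t - dphi t * s =
      (F (x2 + (t + s) *: D) - F (x2 + t *: D) - (s *: D) *m jac F (x2 + t *: D)) k i.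
    by rewrite -scalemxAl !mxE /phi /dphi [X in _ - X]mulrC mxE.
  apply: le_trans (mx_entry_norm _ _ _) _; apply: le_trans H _.
  have -> : eps / (`|D| + 1) * (`|s| * `|D|) = (eps * `|s|) * (`|D| / (`|D| + 1)) by ring.
  apply: ler_piMr; first by rewrite mulr_ge0// ltW.
  by rewrite ler_pdivrMr// mul1r lerDl.
have [c /[!in_itv]/= /andP[c0 c1] Hc] : exists2 c, c \in `]0, 1[ & phi 1 - phi 0 = dphi c * (1 - 0).
  apply: MVT => // [t|].
    rewrite in_itv/= => /andP[t0 t1]; apply: has_der_derive; apply: Hder.
    by rewrite !ltW.
  apply: derivable_within_continuous => t; rewrite in_itv/= => t01.
  by have [] := has_der_derive (Hder t t01).
have -> : (F x1 - F x2) k i = phi 1 - phi 0.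
  by rewrite /phi scale1r scale0r addr0 [x2 + D]addrC subrK !mxE.
rewrite Hc subr0 mulr1; apply: le_trans (mx_entry_norm _ _ _) _.
apply: le_trans (mulmx_norm _ _) _; rewrite mulrAC ler_wpM2r// ler_wpM2l//.
by apply: JK; rewrite !ltW.
Qed.

End SmoothMap.

(** With J at the reference point, y1 J1^T - y2 J2^T is the known difference of the x^* data, J1 -
    J2 is of the order of the perturbation, and the unknown y1 - y2 meets only the small factor J -
    J1. *)
Lemma adjoint_split (R : realType) (n m : nat) (v y1 y2 : 'rV[R]_m) (J J1 J2 : 'M[R]_(n, m)) :
  (v + (y1 - y2)) *m J^T = v *m J^T + (y1 *m J1^T - y2 *m J2^T)
    + (- y2 *m (J1 - J2)^T) + (y1 - y2) *m (J - J1)^T.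
Proof.
have trB (A B : 'M[R]_(n, m)) : (A - B)^T = A^T - B^T by apply/matrixP => i j; rewrite !mxE.
rewrite !trB mulmxDl !mulmxBr !mulmxBl !mulNmx.
move: (v *m _) (y1 *m _) (y2 *m _) (y1 *m J1^T) (y2 *m J1^T) (y2 *m J2^T) => *.
by apply/rowP => i; rewrite !mxE; ring.
Qed.

Lemma combine_lower_bound (R : realType) (t a b d x : R) :
  0 <= t -> 0 <= 1 - t -> 0 <= a -> 0 <= b -> - x <= d -> 0 <= x ->
  - x <= t * a + (1 - t) * (d + b).
Proof.
move=> t0 t1 a0 b0 xd x0; apply: ler_wpDl; first exact: mulr_ge0.
apply: (@le_trans _ _ ((1 - t) * - x)); first by have := mulr_ge0 t0 x0; lra.
by rewrite ler_wpM2l//; lra.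
Qed.

Section LocalEstimate.
Variables (R : realType) (n m : nat) (F : 'rV[R]_n -> 'rV[R]_m) (g : 'rV[R]_m -> \bar R).
Variables (xb : 'rV[R]_n) (ysb : 'rV[R]_m) (P : 'rV[R]_m -> 'rV[R]_m).
Hypothesis Pg : forall u, subdiff g (P u) (u - P u).
Hypothesis gb : subdiff g (F xb) ysb.
Variables (r0 K L c rho : R).
Hypotheses (r00 : 0 < r0) (K0 : 0 <= K) (L0 : 0 <= L) (c0 : 0 < c) (rho0 : 0 < rho).
Hypothesis FK : forall x1 x2, `|x1 - xb| < r0 -> `|x2 - xb| < r0 ->
  `|F x1 - F x2| <= K * `|x1 - x2|.
Hypothesis JL : forall x1 x2, `|x1 - xb| < r0 -> `|x2 - xb| < r0 ->
  `|jac F x1 - jac F x2| <= L * `|x1 - x2|.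
Local Notation ub := (F xb + ysb).
Local Notation adj := (adjF F xb).
Hypothesis coercive : forall u u', `|u - ub| < rho -> `|u' - ub| < rho ->
  c * dotv (u - u') (u - u') <=
    dotv (u - u') (P u - P u') + dotv (adj (u - u')) (adj (u - u')).

(** If N exceeded the bound, the summand 1 would give d < N; then d^2 <= d N, and division by N
    yields N <= 2/c (a + b) d, a contradiction. *)
Lemma quadratic_absorb (a b N d : R) : 0 <= a -> 0 <= b -> 0 <= N -> 0 <= d ->
  c / 2 * N ^+ 2 <= a * d * N + b * d ^+ 2 -> N <= (1 + 2 / c * (a + b)) * d.
Proof.
move=> a0 b0 N0 d0 H; rewrite leNgt; apply/negP => lt.
have k0 : 0 <= 2 / c * (a + b) by rewrite mulr_ge0 ?divr_ge0 ?addr_ge0// ltW.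
have dN : d < N by apply: le_lt_trans lt; rewrite mulrDl mul1r lerDl mulr_ge0.
have Np : 0 < N by apply: le_lt_trans dN.
have H2 : c / 2 * N ^+ 2 <= (a + b) * d * N.
  apply: le_trans H _; rewrite mulrDl [leRHS]mulrDl lerD2l -mulrA expr2.
  by rewrite ler_wpM2l// ler_wpM2l// ltW.
have H3 : N <= 2 / c * (a + b) * d.
  rewrite -(ler_pM2r Np) -expr2 -(ler_pM2l (_ : 0 < c / 2)) ?divr_gt0//.
  apply: le_trans H2 _; rewrite le_eqVlt; apply/orP; left; apply/eqP.
  by field; rewrite gt_eqF.
by move: lt H3; rewrite mulrDl mul1r; move: (2 / c * (a + b) * d) => z; lra.
Qed.

Let JM := `|jac F xb|.

Lemma adj_norm y : `|adj y| <= m%:R * `|y| * JM.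
Proof. by rewrite /JM -[`|jac F xb|]trmx_norm; exact: mulmx_norm. Qed.

Lemma local_estimate : exists s kappa, [/\ 0 < s, 0 <= kappa &
  forall x1 x2 xs1 xs2 b1 b2 y1 y2 d,
    `|x1 - xb| < s -> `|b1| < s -> `|y1 - ysb| < s ->
    `|x2 - xb| < s -> `|b2| < s -> `|y2 - ysb| < s ->
    Mmap F g (x1, xs1, b1) y1 -> Mmap F g (x2, xs2, b2) y2 ->
    `|x1 - x2| <= d -> `|xs1 - xs2| <= d -> `|b1 - b2| <= d ->
    `|y1 - y2| <= kappa * d].
Proof.
pose q : R := m%:R * L + 1.
have q0 : 0 < q by rewrite ltr_wpDl// mulr_ge0.
(* Since tau^2 <= tau, this gives 2 n tau^2 <= c / 2, so half of the coercivity constant survives;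
   the added 4 covers n = 0. *)
pose tau := Num.min 1 (c / (4 * n%:R + 4)).
have n40 : 0 < 4 * n%:R + 4 :> R by rewrite ltr_wpDl// mulr_ge0.
have tau0 : 0 < tau by rewrite lt_min ltr01 divr_gt0.
(* [r0] gives the Lipschitz bounds, 1 bounds the multipliers, tau / q makes the Jacobian error
   small, and rho / (K + 3) puts both u_i where coercivity holds. *)
pose s := Num.min r0 (Num.min 1 (Num.min (tau / q) (rho / (K + 3)))).
have K30 : 0 < K + 3 by rewrite ltr_wpDl.
have s0 : 0 < s by rewrite !lt_min r00 ltr01 !divr_gt0.
have sr : s <= r0 by rewrite ge_min lexx.
have s1 : s <= 1 by rewrite !ge_min lexx orbT.
have stau : m%:R * L * s <= tau.
  apply: (@le_trans _ _ (q * s)); first by rewrite ler_pM2r// /q lerDl.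
  by rewrite -ler_pdivlMl// mulrC !ge_min lexx !orbT.
have srho : (K + 3) * s <= rho.
  by rewrite -ler_pdivlMl// mulrC !ge_min lexx !orbT.
(* In units of d, the summands bound adj eta, the x^* difference, the change of Jacobian acting on
   y2, and the share of eta in the last term of [adjoint_split]. *)
pose A := m%:R * (K + 1) * JM + 1 + m%:R * (`|ysb| + 1) * L + m%:R * L * (K + 1).
have JM0 : 0 <= JM by exact: normr_ge0.
have K10 : 0 <= K + 1 by rewrite addr_ge0.
have A0 : 0 <= A.
  have h1 : 0 <= m%:R * (K + 1) * JM by rewrite mulr_ge0// mulr_ge0.
  have h2 : 0 <= m%:R * (`|ysb| + 1) * L by rewrite mulr_ge0// mulr_ge0// addr_ge0.
  have h3 : 0 <= m%:R * L * (K + 1) by rewrite mulr_ge0// mulr_ge0.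
  by rewrite /A addr_ge0// addr_ge0// addr_ge0.
pose a := m%:R * (K + 1); pose b := 2 * n%:R * A ^+ 2.
have a0 : 0 <= a by rewrite mulr_ge0.
have b0 : 0 <= b by rewrite mulr_ge0 ?mulr_ge0// exprn_ge0.
pose k1 := 1 + 2 / c * (a + b).
have k10 : 0 <= k1 by rewrite addr_ge0// mulr_ge0 ?divr_ge0 ?addr_ge0// ltW.
exists s, (k1 + (K + 1)); split => //; first by rewrite addr_ge0.
move=> x1 x2 xs1 xs2 b1 b2 y1 y2 d hx1 hb1 hy1 hx2 hb2 hy2 [/= g1 E1] [/= g2 E2] dx dxs db.
have d0 : 0 <= d by apply: le_trans dx.
have in_r x : `|x - xb| < s -> `|x - xb| < r0 by move=> /lt_le_trans; apply.
have xb_r : `|xb - xb| < r0 by rewrite subrr normr0.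
pose v1 := F x1 + b1; pose v2 := F x2 + b2.
have Pu1 : P (v1 + y1) = v1 by exact/(resolvent_graph Pg).
have Pu2 : P (v2 + y2) = v2 by exact/(resolvent_graph Pg).
have near_ub x bx y : `|x - xb| < s -> `|bx| < s -> `|y - ysb| < s ->
    `|F x + bx + y - ub| < rho.
  move=> hx hb hy.
  have -> : F x + bx + y - ub = (F x - F xb) + bx + (y - ysb).
    by apply/rowP => i; rewrite !mxE; ring.
  apply: lt_le_trans srho; apply: le_lt_trans (ler_normD _ _) _.
  apply: le_lt_trans (lerD (ler_normD _ _) (lexx _)) _.
  have H1 : `|F x - F xb| <= K * s.
    by apply: le_trans (FK (in_r _ hx) xb_r) _; rewrite ler_wpM2l// ltW.
  by move: H1 hb hy s0; lra.
have := coercive (near_ub _ _ _ hx1 hb1 hy1) (near_ub _ _ _ hx2 hb2 hy2).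
rewrite -/v1 -/v2 Pu1 Pu2; set D := v1 + y1 - (v2 + y2); set eta := v1 - v2 => co.
pose zeta := y1 - y2.
have DE : D = eta + zeta by rewrite /D /eta /zeta opprD addrACA.
have Heta : `|eta| <= (K + 1) * d.
  have -> : eta = (F x1 - F x2) + (b1 - b2) by rewrite /eta /v1 /v2 opprD addrACA.
  apply: le_trans (ler_normD _ _) _; rewrite mulrDl mul1r lerD//.
  by apply: le_trans (FK (in_r _ hx1) (in_r _ hx2)) _; rewrite ler_wpM2l.
have Hzeta : `|zeta| <= `|D| + (K + 1) * d.
  have -> : zeta = D - eta by rewrite DE addrC addKr.
  by apply: le_trans (ler_normB _ _) _; rewrite lerD2l.
have Hy2 : `|y2| <= `|ysb| + 1.
  have -> : y2 = ysb + (y2 - ysb) by rewrite addrC subrK.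
  by apply: le_trans (ler_normD _ _) _; rewrite lerD2l; apply: le_trans (ltW hy2) _.
have Hadj : `|adj D| <= A * d + tau * `|D|.
  have -> : adj D = adj eta + (xs1 - xs2) + (- y2 *m (jac F x1 - jac F x2)^T)
      + zeta *m (jac F xb - jac F x1)^T.
    by rewrite -E1 -E2 DE; exact: adjoint_split.
  apply: le_trans (ler_normD _ _) _.
  apply: le_trans (lerD (ler_normD _ _) (lexx _)) _.
  apply: le_trans (lerD (lerD (ler_normD _ _) (lexx _)) (lexx _)) _.
  have T1 : `|adj eta| <= m%:R * (K + 1) * JM * d.
    apply: le_trans (adj_norm _) _.
    have -> : m%:R * (K + 1) * JM * d = m%:R * ((K + 1) * d) * JM by ring.
    by rewrite ler_wpM2r// ler_wpM2l.
  have T2 : `|- y2 *m (jac F x1 - jac F x2)^T| <= m%:R * (`|ysb| + 1) * L * d.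
    apply: le_trans (mulmx_norm _ _) _; rewrite normrN trmx_norm -!mulrA.
    rewrite ler_wpM2l// ler_pM//.
    by apply: le_trans (JL (in_r _ hx1) (in_r _ hx2)) _; rewrite ler_wpM2l.
  have T3 : `|zeta *m (jac F xb - jac F x1)^T| <= tau * `|D| + m%:R * L * (K + 1) * d.
    apply: le_trans (mulmx_norm _ _) _; rewrite trmx_norm.
    apply: (@le_trans _ _ (m%:R * `|zeta| * (L * s))).
      rewrite ler_wpM2l ?mulr_ge0//; apply: le_trans (JL xb_r (in_r _ hx1)) _.
      by rewrite ler_wpM2l// distrC ltW.
    have -> : m%:R * `|zeta| * (L * s) = m%:R * L * s * `|zeta| by ring.
    apply: (@le_trans _ _ (m%:R * L * s * (`|D| + (K + 1) * d))).
      by rewrite ler_wpM2l// !mulr_ge0// ltW.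
    rewrite mulrDr lerD//; first by rewrite ler_wpM2r.
    rewrite -[leRHS]mulrA ler_wpM2r ?mulr_ge0//.
    by rewrite ler_piMr// mulr_ge0.
  apply: le_trans (lerD (lerD (lerD T1 dxs) T2) T3) _.
  by rewrite le_eqVlt; apply/orP; left; apply/eqP; rewrite /A; ring.
have Hadj2 : dotv (adj D) (adj D) <= b * d ^+ 2 + c / 2 * `|D| ^+ 2.
  apply: le_trans (ler_norm _) _; apply: le_trans (dotv_norm_le _ _) _.
  rewrite -mulrA -expr2.
  apply: (@le_trans _ _ (n%:R * (2 * (A * d) ^+ 2 + 2 * (tau * `|D|) ^+ 2))).
    rewrite ler_wpM2l//; apply: (@le_trans _ _ ((A * d + tau * `|D|) ^+ 2)).
      have AD0 : 0 <= A * d + tau * `|D|.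
        by apply: addr_ge0; apply: mulr_ge0 => //; exact: ltW.
      by rewrite ler_sqr ?nnegrE.
    have := sqr_ge0 (A * d - tau * `|D|); rewrite sqrrB sqrrD.
    by move: (_ * d) (tau * _) => ? ?; lra.
  have -> : n%:R * (2 * (A * d) ^+ 2 + 2 * (tau * `|D|) ^+ 2) =
    b * d ^+ 2 + 2 * n%:R * tau ^+ 2 * `|D| ^+ 2 by rewrite /b; ring.
  rewrite lerD2l ler_wpM2r ?sqr_ge0//.
  have t1 : tau ^+ 2 <= tau.
    by rewrite expr2; apply: ler_piMr; [exact: ltW|rewrite ge_min lexx].
  have t2 : (4 * n%:R + 4) * tau <= c by rewrite -ler_pdivlMl// mulrC ge_min lexx orbT.
  apply: (@le_trans _ _ (2 * n%:R * tau)); first by rewrite ler_wpM2l ?mulr_ge0.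
  by move: t2 tau0; lra.
have Hdot : dotv D eta <= a * d * `|D|.
  apply: le_trans (ler_norm _) _; apply: le_trans (dotv_norm_le _ _) _.
  have -> : a * d * `|D| = m%:R * `|D| * ((K + 1) * d) by rewrite /a; ring.
  by rewrite ler_wpM2l// mulr_ge0.
have HD : `|D| <= k1 * d.
  apply: quadratic_absorb => //.
  have : c * `|D| ^+ 2 <= c * dotv D D by rewrite ler_pM2l// norm_sqr_le_dotv.
  by move: co Hadj2 Hdot; lra.
by rewrite -/zeta; apply: le_trans Hzeta _; rewrite [leRHS]mulrDl lerD2r.
Qed.

(* Multipliers far from ysb are pulled back along segments to the sphere of radius s / 2 about ysb;
   a limit of these points is a multiplier at the reference point, by monotonicity. *)
Lemma multiplier_localized s : 0 < s ->
  (forall y, Mmap F g (xb, adj ysb, 0) y -> `|y - ysb| < s -> y = ysb) ->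
  exists2 e, 0 < e & forall x xs b y, `|x - xb| < e -> `|xs - adj ysb| < e -> `|b| < e ->
    Mmap F g (x, xs, b) y -> `|y - ysb| < s.
Proof.
move=> s0 uniq; apply: contrapT => nex.
have /choice[z Hz] : forall k : nat, exists z : 'rV[R]_n * 'rV[R]_n * 'rV[R]_m * 'rV[R]_m,
    [/\ `|z.1.1.1 - xb| < Num.min r0 k.+1%:R^-1, `|z.1.1.2 - adj ysb| < k.+1%:R^-1,
        `|z.1.2| < k.+1%:R^-1, Mmap F g z.1 z.2 & s <= `|z.2 - ysb|].
  move=> k; apply: contrapT => nz; apply: nex.
  exists (Num.min r0 k.+1%:R^-1); first by rewrite lt_min r00 invr_gt0 ltr0Sn.
  move=> x xs b y hx hxs hb My; rewrite ltNge; apply/negP => sy; apply: nz.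
  exists (x, xs, b, y); split => //=.
    by move: hxs; rewrite lt_min => /andP[].
  by move: hb; rewrite lt_min => /andP[].
(* At distance s / 2 the limit lies within the range of uniqueness and yet differs from [ysb]. *)
pose t k := s / 2 / `|(z k).2 - ysb|.
have Yk k : 0 < `|(z k).2 - ysb| by have [_ _ _ _] := Hz k; apply: lt_le_trans.
have t0 k : 0 <= t k by rewrite /t !divr_ge0// ltW.
have t1 k : t k <= 1.
  rewrite /t ler_pdivrMr// mul1r; have [_ _ _ _ H] := Hz k.
  by apply: le_trans H; move: s0; lra.
pose w k := ysb + t k *: ((z k).2 - ysb).
have wE k : `|w k - ysb| = s / 2.
  by rewrite /w addrAC subrr add0r normrZ ger0_norm// /t divfK// gt_eqF.
have wb k : `|w k| <= `|ysb| + s / 2.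
  have -> : w k = ysb + (w k - ysb) by rewrite addrC subrK.
  by apply: le_trans (ler_normD _ _) _; rewrite wE.
have [p ple [wl lw]] := bounded_extract wb.
have pinv k : (p k).+1%:R^-1 <= k.+1%:R^-1 :> R by rewrite lef_pV2 ?posrE// ler_nat ltnS.
have xb_r : `|xb - xb| < r0 by rewrite subrr normr0.
have xr k : `|(z k).1.1.1 - xb| < r0.
  by have [] := Hz k; rewrite lt_min => /andP[].
have xk k : `|(z (p k)).1.1.1 - xb| <= k.+1%:R^-1.
  have [H _ _ _ _] := Hz (p k); move: H; rewrite lt_min => /andP[_ H].
  by apply: le_trans (ltW H) _.
pose v k := F (z (p k)).1.1.1 + (z (p k)).1.2.
have lv : tends v (F xb).
  apply: (@tends_squeeze _ _ _ _ _ (K + 1)) => k; rewrite /v addrAC.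
  apply: le_trans (ler_normD _ _) _; rewrite mulrDl mul1r lerD//.
    by apply: le_trans (FK (xr _) xb_r) _; rewrite ler_wpM2l.
  by have [_ _ H _ _] := Hz (p k); apply: le_trans (ltW H) _.
have lJ : tends (fun k => jac F (z (p k)).1.1.1) (jac F xb).
  apply: (@tends_squeeze _ _ _ _ _ L) => k.
  by apply: le_trans (JL (xr _) xb_r) _; rewrite ler_wpM2l.
have lyJ : tends (fun k => ysb *m (jac F (z (p k)).1.1.1)^T) (adj ysb).
  exact: tends_mulmx (tends_cst ysb) (tends_trmx lJ).
have lxs : tends (fun k => (z (p k)).1.1.2) (adj ysb).
  apply: (@tends_squeeze _ _ _ _ _ 1) => k; rewrite mul1r.
  by have [_ H _ _ _] := Hz (p k); apply: le_trans (ltW H) _.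
have wJ : adj wl = adj ysb.
  apply: (tends_unique (tends_mulmx lw (tends_trmx lJ))) => e e0.
  have e2 : 0 < e / 2 by rewrite divr_gt0.
  have [N1 H1] := lyJ _ e2.
  have ld := tends_sub lxs lyJ; rewrite subrr in ld.
  have [N2 H2] := ld _ e2.
  exists (maxn N1 N2) => k; rewrite geq_max => /andP[/H1 {}H1 /H2 {}H2].
  have [_ _ _ [_ /= EJ] _] := Hz (p k).
  have -> : w (p k) *m (jac F (z (p k)).1.1.1)^T - adj ysb =
     (ysb *m (jac F (z (p k)).1.1.1)^T - adj ysb)
     + t (p k) *: ((z (p k)).1.1.2 - ysb *m (jac F (z (p k)).1.1.1)^T).
    by rewrite /w mulmxDl -scalemxAl mulmxBl -EJ addrAC.
  apply: le_lt_trans (ler_normD _ _) _; rewrite (splitr e) ltrD//.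
  apply: le_lt_trans H2; rewrite subr0 normrZ ger0_norm//.
  by rewrite ler_piMl.
(* Minty's device: the monotonicity inequality against the resolvent pair (y', ys') of F xb + wl
   passes to the limit, where wl - ys' = - (F xb - y') forces y' = F xb. *)
have wg : subdiff g (F xb) wl.
  apply/(resolvent_graph Pg); set y' := P _; pose ys' := F xb + wl - y'.
  have gy' : subdiff g y' ys' by exact: Pg.
  pose C := m%:R * `|ysb - ys'|.
  have C0 : 0 <= C by rewrite mulr_ge0.
  (* [w (p k)] need not be a subgradient at [v k]: it combines one at [v k] with [ysb], which is one
     at [F xb]. The mismatch of base points costs C |v k - F xb|. *)
  have low k : - (C * `|v k - F xb|) <= dotv (w (p k) - ys') (v k - y').
    have [_ _ _ [/= gk _] _] := Hz (p k).
    have m1 : 0 <= dotv ((z (p k)).2 - ys') (v k - y').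
      by rewrite dotvC; exact: subdiff_monotone gk gy'.
    have m2 : 0 <= dotv (ysb - ys') (F xb - y').
      by rewrite dotvC; exact: subdiff_monotone gb gy'.
    have m3 : - (C * `|v k - F xb|) <= dotv (ysb - ys') (v k - F xb).
      by have := dotv_norm_le (ysb - ys') (v k - F xb); rewrite ler_norml => /andP[].
    have -> : w (p k) - ys' = t (p k) *: ((z (p k)).2 - ys') + (1 - t (p k)) *: (ysb - ys').
      by rewrite /w; apply/rowP => i; rewrite !mxE; ring.
    rewrite dotvDl !dotvZl.
    have -> : dotv (ysb - ys') (v k - y') =
        dotv (ysb - ys') (v k - F xb) + dotv (ysb - ys') (F xb - y').
      by rewrite -dotvDr addrA subrK.
    by apply: combine_lower_bound; rewrite ?subr_ge0// mulr_ge0.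
  have lim : tends (fun k => (w (p k) - ys') *m (v k - y')^T) ((wl - ys') *m (F xb - y')^T).
    exact: tends_mulmx (tends_sub lw (tends_cst _)) (tends_trmx (tends_sub lv (tends_cst _))).
  have ge0 : 0 <= dotv (wl - ys') (F xb - y').
    apply/ler_addgt0Pr => e e0; have e2 : 0 < e / 2 by rewrite divr_gt0.
    have [N1 H1] := lim _ e2.
    have eC : 0 < e / 2 / (C + 1) by rewrite divr_gt0// ltr_wpDl.
    have [N2 H2] := lv _ eC.
    have {}H1 := le_lt_trans (mx_entry_norm _ ord0 ord0) (H1 (maxn N1 N2) (leq_maxl _ _)).
    have {}H2 := H2 (maxn N1 N2) (leq_maxr _ _).
    have H3 := low (maxn N1 N2).
    move: H1; rewrite mxE [X in _ + X]mxE -!dotvE ltr_norml => /andP[_ H1].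
    have H4 : C * `|v (maxn N1 N2) - F xb| <= e / 2.
      apply: (@le_trans _ _ ((C + 1) * `|v (maxn N1 N2) - F xb|)).
        by rewrite ler_wpM2r// lerDl.
      by rewrite -ler_pdivlMl ?ltr_wpDl// mulrC ltW.
    by lra.
  have E : wl - ys' = - (F xb - y').
    by rewrite /ys'; apply/rowP => i; rewrite !mxE; ring.
  move: ge0; rewrite E dotvNl oppr_ge0 => /dotv_eq0/eqP.
  by rewrite subr_eq0 eq_sym => /eqP.
have s2 : 0 < s / 2 by rewrite divr_gt0.
have [N HN] := lw _ s2; have {}HN := HN N (leqnn N).
have wls : wl = ysb.
  apply: uniq; first by split; rewrite /= ?addr0.
  rewrite -(subrKA (w (p N))); apply: le_lt_trans (ler_normD _ _) _.
  by rewrite wE [ltRHS]splitr ltrD2r distrC.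
by move: HN; rewrite wls wE ltxx.
Qed.

End LocalEstimate.

Lemma convex_comb_lt (R : realType) (t a b r : R) :
  0 <= t -> t <= 1 -> a < r -> b < r -> t * a + (1 - t) * b < r.
Proof.
move=> t0 t1 ar br; have [->|tn] := eqVneq t 0; first by rewrite mul0r add0r subr0 mul1r.
have tp : 0 < t by rewrite lt_neqAle eq_sym tn.
have H1 : t * a < t * r by rewrite ltr_pM2l.
have H2 : (1 - t) * b <= (1 - t) * r by rewrite ler_wpM2l ?subr_ge0// ltW.
by lra.
Qed.

Theorem theorem3p7 (R : realType) (n m : nat)
  (F : 'rV[R]_n -> 'rV[R]_m) (g : 'rV[R]_m -> \bar R) (xb : 'rV[R]_n) (ysb : 'rV[R]_m) :
  (* F continuously differentiable around xb *)
  (\forall x \near xb, differentiable F x /\ {for x, continuous (jac F)}) ->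
  (* g : R^m -> R \cup {+oo}, lsc and convex *)
  (forall y, g y != -oo%E) ->
  lower_semicontinuous g ->
  convex_ext g ->
  (* yb := F xb in dom g *)
  (g (F xb) < +oo)%E ->
  subdiff g (F xb) ysb ->
  (* SOQC at xb for ysb *)
  SOQC F g xb ysb ->
  (* nabla F Lipschitz near xb *)
  (exists r : R, exists Lc : R, 0 < r /\ forall x1 x2,
     ball xb r x1 -> ball xb r x2 -> `|jac F x1 - jac F x2| <= Lc * `|x1 - x2|) ->
  exists W : set ('rV[R]_n * 'rV[R]_n * 'rV[R]_m),
  exists kappa : R,
    nbhs (xb, adjF F xb ysb, (0 : 'rV[R]_m)) W /\ 0 <= kappa /\
    (forall p1 p2 : 'rV[R]_n * 'rV[R]_n * 'rV[R]_m, W p1 -> W p2 ->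
       forall y1 y2, Mmap F g p1 y1 -> Mmap F g p2 y2 ->
         `|y1 - y2| <= kappa * Num.max `|p1.1.1 - p2.1.1|
                                 (Num.max `|p1.1.2 - p2.1.2| `|p1.2 - p2.2|)) /\
    (forall p, W p -> forall y1 y2, Mmap F g p y1 -> Mmap F g p y2 -> y1 = y2).
Proof.
move=> Fdiff gNy glsc gconv gfin gb soqc [r [Lc [r_gt0 JLc]]].
have /choice[P Pg] : forall u, exists y, subdiff g y (u - y).
  exact: (resolvent_exists gNy glsc gconv gb).
have [c [rho [c0 rho0 Hder]]] := resolvent_coercive_deriv Pg gb soqc.
have /nbhs_ballP[r1 /= r10 Hr1] := Fdiff.
pose r0 := Num.min r r1.
have r00 : 0 < r0 by rewrite lt_min r_gt0.
have in_ball (x : 'rV[R]_n) e : `|x - xb| < e -> ball xb e x.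
  by rewrite -ball_normE /= distrC.
have [r0r r0r1] : r0 <= r /\ r0 <= r1 by split; rewrite ge_min lexx ?orbT.
have xb_r : `|xb - xb| < r0 by rewrite subrr normr0 r00.
(* The sign of [Lc] is not prescribed. *)
pose L := `|Lc|; have L0 : 0 <= L by exact: normr_ge0.
have JL x1 x2 : `|x1 - xb| < r0 -> `|x2 - xb| < r0 ->
    `|jac F x1 - jac F x2| <= L * `|x1 - x2|.
  move=> h1 h2; apply: le_trans (JLc _ _ _ _) _.
  - by apply: in_ball; exact: lt_le_trans h1 r0r.
  - by apply: in_ball; exact: lt_le_trans h2 r0r.
  by rewrite ler_wpM2r// ler_norm.
pose K0 := `|jac F xb| + L * r0.
have K00 : 0 <= K0 by rewrite addr_ge0// mulr_ge0// ltW.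
have FK x1 x2 : `|x1 - xb| < r0 -> `|x2 - xb| < r0 ->
    `|F x1 - F x2| <= (n%:R * K0) * `|x1 - x2|.
  move=> h1 h2.
  have seg (t : R) : 0 <= t <= 1 -> `|x2 + t *: (x1 - x2) - xb| < r0.
    move=> /andP[t0 t1].
    have -> : x2 + t *: (x1 - x2) - xb = t *: (x1 - xb) + (1 - t) *: (x2 - xb).
      by apply/rowP => i; rewrite !mxE; ring.
    apply: le_lt_trans (ler_normD _ _) _; rewrite !normrZ !ger0_norm ?subr_ge0//.
    exact: convex_comb_lt.
  apply: mean_value_bound => // t /seg ht.
    by have [] := Hr1 _ (in_ball _ _ (lt_le_trans ht r0r1)).
  rewrite -[jac F _](subrK (jac F xb)) addrC; apply: le_trans (ler_normD _ _) _.
  rewrite lerD2l; apply: le_trans (JL _ _ ht xb_r) _.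
  by rewrite ler_wpM2l// ltW.
have coercive u u' : `|u - (F xb + ysb)| < rho -> `|u' - (F xb + ysb)| < rho ->
    c * dotv (u - u') (u - u') <= dotv (u - u') (P u - P u')
      + dotv (adjF F xb (u - u')) (adjF F xb (u - u')).
  (* The terms free of B form the constant [ga] of the mean value lemma; this is where affinity in B
     enters. *)
  move=> hu hu'; rewrite -lerBlDr.
  (* The whole segment stays within d of the centre, so rho - d is the room for shifting it. *)
  pose d := Num.max `|u - (F xb + ysb)| `|u' - (F xb + ysb)|.
  have drho : d < rho by rewrite gt_max hu.
  apply: (resolvent_mean_value Pg (C := [set x | `|x - (F xb + ysb)| < rho]) (rho := rho - d)).
  - by rewrite subr_gt0.
  - move=> x t hx /andP[t0 t1] /=.
    have -> : x + t *: (u - u') - (F xb + ysb) =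
        (x - u') + (t *: (u - (F xb + ysb)) + (1 - t) *: (u' - (F xb + ysb))).
      by apply/rowP => i; rewrite !mxE; ring.
    apply: le_lt_trans (ler_normD _ _) _; rewrite -(subrK d rho); apply: ltr_leD => //.
    apply: le_trans (ler_normD _ _) _.
    rewrite !normrZ (gtr0_norm t0) gtr0_norm ?subr_gt0//.
    apply: (@le_trans _ _ (t * d + (1 - t) * d)); last by rewrite -mulrDl addrC subrK mul1r.
    by apply: lerD; apply: ler_wpM2l;
      rewrite ?subr_ge0 ?le_max ?lexx ?orbT// ltW.
  - by move=> x B hx HB; rewrite lerBlDr; exact: Hder HB.
have [s [kappa [s0 kappa0 est]]] :=
  local_estimate Pg r00 (mulr_ge0 (ler0n R n) K00) L0 c0 rho0 FK JL coercive.
have Mb : Mmap F g (xb, adjF F xb ysb, 0) ysb by split; rewrite /= ?addr0.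
(* The local estimate for two multipliers of the same parameter, with d = 0. *)
have uniq y : Mmap F g (xb, adjF F xb ysb, 0) y -> `|y - ysb| < s -> y = ysb.
  move=> My hy; apply/eqP; rewrite -subr_eq0 -normr_le0 -(mulr0 kappa).
  by apply: est My Mb _ _ _; rewrite ?subrr ?normr0.
have [e e0 loc] := multiplier_localized Pg gb r00
  (mulr_ge0 (ler0n R n) K00) L0 FK JL s0 uniq.
pose e' := Num.min e s.
have e'0 : 0 < e' by rewrite lt_min e0.
have [e'e e's] : e' <= e /\ e' <= s by split; rewrite ge_min lexx ?orbT.
pose W : set ('rV[R]_n * 'rV[R]_n * 'rV[R]_m) :=
  [set p | [/\ `|p.1.1 - xb| < e', `|p.1.2 - adjF F xb ysb| < e' & `|p.2| < e']].
have Wy p y : W p -> Mmap F g p y -> `|y - ysb| < s.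
  case: p => [[x xs] b] [/= h1 h2 h3]; apply: loc; exact: lt_le_trans e'e.
have Lip p1 p2 : W p1 -> W p2 -> forall y1 y2, Mmap F g p1 y1 -> Mmap F g p2 y2 ->
    `|y1 - y2| <= kappa * Num.max `|p1.1.1 - p2.1.1|
                            (Num.max `|p1.1.2 - p2.1.2| `|p1.2 - p2.2|).
  move=> W1 W2 y1 y2 M1 M2; have hy1 := Wy _ _ W1 M1; have hy2 := Wy _ _ W2 M2.
  case: p1 p2 W1 W2 M1 M2 => [[x1 xs1] b1] [[x2 xs2] b2] [/= a1 a2 a3] [/= a4 a5 a6] M1 M2.
  apply: (est _ _ _ _ _ _ _ _ _ _ _ _ _ _ _ M1 M2) => //; try exact: lt_le_trans e's.
  - by rewrite le_max lexx.
  - by rewrite !le_max lexx orbT.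
  - by rewrite !le_max lexx !orbT.
exists W, kappa; split.
  apply/nbhs_ballP; exists e' => //= -[[x xs] b] [[/= h1 h2] h3].
  move: h1 h2 h3; rewrite -!ball_normE /= sub0r normrN => h1 h2 h3.
  by split; rewrite // distrC.
split => //; split => // p Wp y1 y2 M1 M2; apply/eqP; rewrite -subr_eq0 -normr_le0.
apply: le_trans (Lip p p Wp Wp y1 y2 M1 M2) _.
by rewrite !subrr !normr0 !maxxx mulr0.
Qed.
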